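(* The following decision problem is in co-NP: given a finite 3-graph $H=(V,\Delta)$ (listed by its vertices and triples), decide whether $H$ has a 3-Pfaffian orientation.
   Context: A 3-graph is a pair $H=(V,\Delta)$ with $V$ a finite set and $\Delta\subseteq\binom{V}{3}$; elements of $\Delta$ are called triples. A cycle in $H$ is a sequence $a_0,t_1,a_1,\dots,a_{\ell-1},t_\ell,a_\ell=a_0$ with $\ell\ge 2$, $a_0,\dots,a_{\ell-1}$ distinct vertices, $t_1,\dots,t_\ell$ distinct triples, and $a_{i-1},a_i\in t_i$ for all $i$ (so two triples sharing two vertices form a cycle). A spanning tree of $H$ is a set $T\subseteq\Delta$ containing no cycle, with $\bigcup T=V$, such that any two vertices are joined by a path using triples of $T$ (a path being a sequence of distinct vertices and distinct triples $a_0,t_1,a_1,\dots,t_\ell,a_\ell$ with $a_{i-1},a_i\in t_i$). Identify $V$ with $[N]$, $N=|V|$, via a fixed linear order. A triple orientation $\omega$ assigns to each triple $t=\{i,j,k\}$ one of its two cyclic orders, i.e. one of the 3-cycles $(i\,j\,k)$, $(j\,i\,k)$ of $[N]$, denoted $\sigma(t,\omega)$. For a spanning tree $T$ (then $N=2n+1$ is odd), the product $\prod_{t\in T}\sigma(t,\omega)$ is an $N$-cycle $(s(1)\,s(2)\,\cdots\,s(N))$ for a permutation $s$ of $[N]$, and the sign $\mathrm{sgn}(T,\omega)$ is the sign of $s$ (this is well defined, independent of the order of the factors and of how the cycle is written). An orientation $\omega$ is 3-Pfaffian if $\mathrm{sgn}(T,\omega)$ is the same for all spanning trees $T$ of $H$;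 $H$ is 3-Pfaffian (has a 3-Pfaffian orientation) if such $\omega$ exists (vacuously true if $H$ has no spanning tree). *)

(* Defs.v *)
From mathcomp Require Import all_boot all_order all_algebra all_fingroup.

Set Implicit Arguments.
Unset Strict Implicit.
Unset Printing Implicit Defensive.

(** * Spanning trees of 3-graphs and 3-Pfaffian orientations *)

(* The vertex set is ['I_N], i.e. [N] with its usual order (numbered from 0). *)
Record graph3 (N : nat) := Graph3 {
  triples : {set {set 'I_N}};
  card_triples : forall t, t \in triples -> #|t| = 3
}.

Section Trees.

Variable V : finType.
Implicit Types (T : {set {set V}}) (x y : V).

(* [t i] is the triple joining [a i] to its cyclic successor [a (ordS i)]. *)
Definition has_cycle T : Prop :=
  exists (l : nat) (a : 'I_l -> V) (t : 'I_l -> {set V}),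
    [/\ 2 <= l, injective a, injective t &
        forall i, [/\ t i \in T, a i \in t i & a (ordS i) \in t i]].

(* [t i] joins the i-th vertex of the path to the (i+1)-st one. *)
Definition joined T x y : Prop :=
  exists (l : nat) (a : 'I_l.+1 -> V) (t : 'I_l -> {set V}),
    [/\ injective a, injective t, a ord0 = x, a ord_max = y &
        forall i, [/\ t i \in T, a (widen_ord (leqnSn l) i) \in t i
                    & a (lift ord0 i) \in t i]].

Definition spanning_tree (D T : {set {set V}}) : Prop :=
  [/\ T \subset D, ~ has_cycle T, cover T = [set: V]
    & forall x y, joined T x y].

(* [p] is the cyclic permutation written (c_1 c_2 ... c_m); [next c] maps each
   c_i to its cyclic successor and fixes every point outside [c]. *)
Definition is_cycle_notation (c : seq V) (p : {perm V}) : bool :=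
  uniq c && [forall x, p x == next c x].

End Trees.

Definition triple_orientation N (H : graph3 N)
    (omega : {set 'I_N} -> {perm 'I_N}) : Prop :=
  forall t, t \in triples H ->
    exists i j k, t = [set i; j; k] /\ is_cycle_notation [:: i; j; k] (omega t).

(* The product is (s(1) ... s(N)) for some [s] whenever [T] is a spanning tree;
   neither the order of the factors nor the choice of [s] affects the sign.
   The value 0 is only taken when there is no such [s]. *)
Definition sgn N (omega : {set 'I_N} -> {perm 'I_N}) (T : {set {set 'I_N}})
    : int :=
  if [pick s : {perm 'I_N} |
       is_cycle_notation [seq s i | i <- enum 'I_N]
                         (\prod_(t in T) omega t)%g] is Some s
  then ((-1) ^+ (s : bool))%R else 0%R.

Definition pfaffian_orientation N (H : graph3 N) omega : Prop :=
  triple_orientation H omega /\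
  forall T1 T2, spanning_tree (triples H) T1 -> spanning_tree (triples H) T2 ->
    sgn omega T1 = sgn omega T2.

Definition pfaffian3 N (H : graph3 N) : Prop :=
  exists omega, pfaffian_orientation H omega.

(** * Deterministic multitape Turing machines *)

Inductive head_move := MoveLeft | MoveRight | Stay.

(* Input alphabet [Sigma], work alphabet [Sigma + aux]; [None] is the blank.
   A state with [verdict q = Some b] is halting: accepting if [b], rejecting
   otherwise. The machine has [ntapes.+1] tapes, tape [ord0] being the input
   tape. *)
Record machine (Sigma : finType) := Machine {
  ntapes : nat;
  aux : finType;
  state : finType;
  start : state;
  verdict : state -> option bool;
  delta : state -> {ffun 'I_ntapes.+1 -> option (Sigma + aux)} ->
          state * ('I_ntapes.+1 -> option (Sigma + aux) * head_move)
}.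

(* A two-way infinite tape: scanned cell, and the cells on either side of it,
   nearest first, all cells beyond the lists being blank. *)
Record tape (A : Type) := Tape {
  lcells : seq (option A);
  scanned : option A;
  rcells : seq (option A)
}.

Definition tape_of A (w : seq A) : tape A :=
  if w is a :: w' then Tape [::] (Some a) (map Some w')
  else Tape [::] None [::].

Definition write_move A (wm : option A * head_move) (tp : tape A) : tape A :=
  let: Tape l _ r := tp in
  match wm.2 with
  | MoveLeft  => Tape (behead l) (head None l) (wm.1 :: r)
  | MoveRight => Tape (wm.1 :: l) (head None r) (behead r)
  | Stay      => Tape l wm.1 r
  end.

Section Runs.

Variables (Sigma : finType) (M : machine Sigma).

Record config := Config {
  cstate : state M;
  ctapes : 'I_(ntapes M).+1 -> tape (Sigma + aux M)
}.

Definition init (w : seq Sigma) : config :=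
  Config (start M)
    (fun i => if i == ord0 then tape_of [seq inl a | a <- w] else tape_of [::]).

Definition step (c : config) : config :=
  if verdict (cstate c) is Some _ then c else
  let: (q, act) := delta (cstate c) [ffun i => scanned (ctapes c i)] in
  Config q (fun i => write_move (act i) (ctapes c i)).

Definition halts_within (w : seq Sigma) (n : nat) (b : bool) : Prop :=
  verdict (cstate (iter n step (init w))) = Some b.

End Runs.

(** * The classes P, NP and co-NP of languages over a finite alphabet *)

Definition inP (Sigma : finType) (L : seq Sigma -> Prop) : Prop :=
  exists (M : machine Sigma) (p : {poly nat}), forall w,
    exists2 b : bool, halts_within M w p.[size w]%R b & (b <-> L w).

(* The pair of words [w] and [u], separated by the new letter [None]. *)
Definition word_pair (Sigma : finType) (w u : seq Sigma) : seq (option Sigma) :=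
  map Some w ++ None :: map Some u.

Definition inNP (Sigma : finType) (L : seq Sigma -> Prop) : Prop :=
  exists (C : seq (option Sigma) -> Prop) (p : {poly nat}),
    inP C /\
    forall w, L w <-> exists2 u, size u <= p.[size w]%R & C (word_pair w u).

Definition inCoNP (Sigma : finType) (L : seq Sigma -> Prop) : Prop :=
  inNP (fun w => ~ L w).

(** * The decision problem *)

(* Vertex i is named by 1^i 0. Unary names are harmless: since the vertices are
   listed, an input has length at least N, so that the unary and the binary
   encodings have polynomially related lengths. *)
Definition vertex_code (i : nat) : seq bool := rcons (nseq i true) false.

Definition triple_code N (t : 'I_N * 'I_N * 'I_N) : seq bool :=
  let: (i, j, k) := t in vertex_code i ++ vertex_code j ++ vertex_code k.

Definition triple_set N (t : 'I_N * 'I_N * 'I_N) : {set 'I_N} :=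
  let: (i, j, k) := t in [set i; j; k].

(* The word 1^N 0 lists the vertices (one mark per vertex); it is followed by
   the triples, listed in any order, possibly with repetitions. *)
Definition encodes N (w : seq bool) (H : graph3 N) : Prop :=
  exists ts : seq ('I_N * 'I_N * 'I_N),
    w = nseq N true ++ false :: flatten [seq triple_code t | t <- ts] /\
    triples H = [set t in [seq triple_set t | t <- ts]].

Definition PFAFFIAN3 (w : seq bool) : Prop :=
  exists (N : nat) (H : graph3 N), encodes w H /\ pfaffian3 H.

(* Main.v *)
Require Import Defs.
From mathcomp Require Import all_boot all_order all_algebra all_fingroup.
From mathcomp Require Import zify.

(* Grow a spanning tree from the vertex 0 by attaching triples (a, b, c) with a
   old and b, c new. Multiplying the 3-cycles, in whatever order, amounts to
   inserting the adjacent pairs b c into the cycle (0); as moving a pair of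
   adjacent letters is an even permutation, the sign of the tree is that of the
   word 0 b1 c1 b2 c2 ... Hence reversing a triple flips the sign of exactly the
   trees that contain it, and 3-Pfaffian orientations are the solutions of a
   linear system over F_2 with one equation per spanning tree and with one
   unknown per triple and one for the common sign. If it is unsolvable, then
   this is witnessed by at most |Delta| + 2 trees: an even number of them, such
   that every triple lies in an even number of them and the product of their
   signs is -1. The certificate lists these trees as growth sequences.

   It is checked by a program for finitely many read-only heads whose only loop
   construct runs through the positions of the input; such programs take
   polynomial time by construction, and a Turing machine runs them on copies of
   its input, one for each head. *)

Set Implicit Arguments.
Unset Strict Implicit.
Unset Printing Implicit Defensive.

(** * Read-only multi-head programs and their compilation to Turing machines *)

Section Language.

Variable Sigma : finType.

(** Testing a listed set of triples for paths and cycles would need a search. Growth order avoids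
    it: attaching two new vertices to an old one keeps a tree connected and acyclic, so each triple
    is checked against the earlier ones only, and its share of the sign is a count of earlier
    vertices. Such checks suit programs whose memory is a finite type and whose unbounded data are
    head positions alone: unary numbers are compared by advancing two heads in parallel, and what
    cannot be stored, such as the tree in progress, is rescanned. The bound on the number of trees
    is the number of columns of the augmented matrix: one per triple, one for the common sign, one
    for the constant terms. The system is unsolvable exactly when the last unit vector is a
    combination of rows. A maximal independent family of rows then suffices, and over F_2 a
    combination is just a subset. Otherwise a vector killed by the matrix has last entry 1, and its
    other entries give an orientation and a common sign. *)

Inductive expr : finType -> Type :=
| Ret (A : finType) (a : A) : expr A
| Read (h : nat) : expr (option Sigma)
| Bind (A B : finType) (e : expr A) (k : A -> expr B) : expr B
| Loop (T : finType) (M : seq nat) (s0 : T) (body : T -> expr T) : expr T.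

Definition moving (d : nat) (M : seq nat) (i : nat) : bool :=
  (i == d) || (i < d) && (i \in M).

Definition shift (d : nat) (M : seq nat) (k : nat) (env : nat -> nat) :=
  fun i => if i == d then k else if (i < d) && (i \in M) then env i + k else env i.

(* The heads below [d] are in use and the other ones are at 0. A loop adds head
   [d], which counts the iterations; the heads in [M] advance along with it and
   all heads are back in place at the end. *)
Fixpoint eval (W : seq Sigma) (A : finType) (e : expr A) (d : nat)
    (env : nat -> nat) : A :=
  match e in expr A return A with
  | Ret _ a => a
  | Read h => nth None (map Some W) (env h)
  | Bind _ _ e1 k => eval W (k (eval W e1 d env)) d env
  | Loop _ M s0 body =>
      foldl (fun s i => eval W (body s) d.+1 (shift d M i env)) s0
        (iota 0 (size W))
  end.

Fixpoint height (d : nat) (A : finType) (e : expr A) : nat :=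
  match e with
  | Ret _ _ => 0
  | Read h => h.+1
  | Bind A _ e1 k => maxn (height d e1) (\max_(a : A) height d (k a))
  | Loop T _ _ body => maxn d.+1 (\max_(s : T) height d.+1 (body s))
  end.

(** The sum over all continuations bounds the one taken and remains a polynomial. In a loop, 2
    counts the test and the advance of an iteration, and ['X + 2%:P] the failing test and the
    rewind. *)
Fixpoint cost (A : finType) (e : expr A) : {poly nat} :=
  match e with
  | Ret _ _ => 1%R
  | Read _ => 1%R
  | Bind A _ e1 k => (cost e1 + \sum_(a : A) cost (k a))%R
  | Loop T _ _ body =>
      ('X * (\sum_(s : T) cost (body s) + 2%:P) + ('X + 2%:P))%R
  end.

(* In a loop, [(None, s)] tests for the end of the word, [(Some true, s)]
   advances the heads and [(Some false, s)] brings them back. *)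
Fixpoint ctrl (A : finType) (e : expr A) : finType :=
  match e with
  | Ret _ _ => unit
  | Read _ => unit
  | Bind A _ e1 k => (ctrl e1 + {a : A & ctrl (k a)})%type
  | Loop T _ _ body => ({s : T & ctrl (body s)} + (option bool * T))%type
  end.

Fixpoint entry (A : finType) (e : expr A) : ctrl e :=
  match e return ctrl e with
  | Ret _ _ => tt
  | Read _ => tt
  | Bind _ _ e1 _ => inl (entry e1)
  | Loop _ _ s0 _ => inr (None, s0)
  end.

Definition loop_move d M (m : head_move) : nat -> head_move :=
  fun i => if moving d M i then m else Stay.

Fixpoint trans (A : finType) (e : expr A) (d : nat) :
    ctrl e -> (nat -> option Sigma) -> (ctrl e + A) * (nat -> head_move) :=
  match e in expr A
    return ctrl e -> (nat -> option Sigma) -> (ctrl e + A) * (nat -> head_move)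
  with
  | Ret _ a => fun _ _ => (inr a, fun=> Stay)
  | Read h => fun _ syms => (inr (syms h), fun=> Stay)
  | Bind A B e1 k => fun q syms =>
      match q with
      | inl q1 =>
          match trans d q1 syms with
          | (inl q1', m) => (inl (inl q1'), m)
          | (inr a, m) =>
              (inl (inr (existT (fun a => ctrl (k a)) a (entry (k a)))), m)
          end
      | inr (existT a q2) =>
          match trans d q2 syms with
          | (inl q2', m) => (inl (inr (existT (fun a => ctrl (k a)) a q2')), m)
          | (inr b, m) => (inr b, m)
          end
      end
  | Loop T M s0 body => fun q syms =>
      match q with
      | inl (existT s q1) =>
          match trans d.+1 q1 syms with
          | (inl q1', m) =>
              (inl (inl (existT (fun s => ctrl (body s)) s q1')), m)
          | (inr s', m) => (inl (inr (Some true, s')), m)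
          end
      | inr (None, s) =>
          if syms d is Some _ then
            (inl (inl (existT (fun s => ctrl (body s)) s (entry (body s)))),
             fun=> Stay)
          else (inl (inr (Some false, s)), loop_move d M MoveLeft)
      | inr (Some true, s) =>
          (inl (inr (None, s)), loop_move d M MoveRight)
      | inr (Some false, s) =>
          if syms d is Some _ then
            (inl (inr (Some false, s)), loop_move d M MoveLeft)
          else (inr s, loop_move d M MoveRight)
      end
  end.

Definition cell (W : seq Sigma) (p : nat) : option Sigma :=
  if p is p'.+1 then nth None (map Some W) p' else None.

(** The predecessor is truncated at 0; this is why [runs] demands that every head moving left be at
    a positive position. *)
Definition moved (m : head_move) (p : nat) : nat :=
  match m with MoveLeft => p.-1 | MoveRight => p.+1 | Stay => p end.

Section Runs.

Variable W : seq Sigma.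

Lemma cell_None p : (cell W p == None) = (p == 0) || (size W < p).
Proof.
case: p => [|p] //=; rewrite ltnS.
by elim: (W) p => [|a s IH] [|p] //=; rewrite IH.
Qed.

(* Head positions are shifted by one: 0 is the blank left of the word. *)
Inductive runs (A : finType) (e : expr A) (d : nat) :
    nat -> ctrl e -> (nat -> nat) -> A -> (nat -> nat) -> Prop :=
| runs_done q pos a m pos' :
    trans d q (fun h => cell W (pos h)) = (inr a, m) ->
    (forall i, m i = MoveLeft -> 0 < pos i) ->
    (forall i, pos' i = moved (m i) (pos i)) ->
    runs d 1 q pos a pos'
| runs_more t q pos q1 m pos1 a pos' :
    trans d q (fun h => cell W (pos h)) = (inl q1, m) ->
    (forall i, m i = MoveLeft -> 0 < pos i) ->
    (forall i, pos1 i = moved (m i) (pos i)) ->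
    runs d t q1 pos1 a pos' ->
    runs d t.+1 q pos a pos'.

Lemma runs_bind2 A B (e : expr A) (k : A -> expr B) d t a q pos b pos' :
  runs (e := k a) d t q pos b pos' ->
  runs (e := Bind e k) d t (inr (existT (fun a => ctrl (k a)) a q)) pos b pos'.
Proof.
elim=> [{t q pos b pos'}q pos b m pos' E hl hp|{t q pos b pos'}t q pos q1 m pos1 b pos' E hl hp _ IH].
  by apply: runs_done hl hp; rewrite /= E.
by apply: runs_more hl hp IH; rewrite /= E.
Qed.

Lemma runs_bind A B (e : expr A) (k : A -> expr B) d t q pos a pos1 :
  runs (e := e) d t q pos a pos1 -> forall t2 b pos2,
  runs d t2 (entry (k a)) pos1 b pos2 ->
  runs (e := Bind e k) d (t + t2) (inl q) pos b pos2.
Proof.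
elim=> [{t q pos a pos1}q pos a m pos' E hl hp|{t q pos a pos1}t q pos q1 m pos1 a pos' E hl hp _ IH] t2 b pos2 h2.
  by apply: runs_more hl hp (runs_bind2 e h2); rewrite /= E.
by apply: runs_more hl hp (IH _ _ _ h2); rewrite /= E.
Qed.

Lemma runs_body (T : finType) M (s0 : T) body d t s q pos s' pos1 :
  runs (e := body s) d.+1 t q pos s' pos1 -> forall t2 r pos2,
  runs (e := Loop M s0 body) d t2 (inr (Some true, s')) pos1 r pos2 ->
  runs (e := Loop M s0 body) d (t + t2)
    (inl (existT (fun s => ctrl (body s)) s q)) pos r pos2.
Proof.
elim=> [{t q pos s' pos1}q pos a m pos' E hl hp|{t q pos s' pos1}t q pos q1 m pos1 a pos' E hl hp _ IH] t2 b pos2 h2.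
  by apply: runs_more hl hp h2; rewrite /= E.
by apply: runs_more hl hp (IH _ _ _ h2); rewrite /= E.
Qed.

(** [j = 1] is the starting position, since tape positions are one ahead of [env]; [j = 0] occurs
    only at the end of the rewind. *)
Definition loop_pos d M (env : nat -> nat) j i :=
  if moving d M i then env i + j else (env i).+1.

(** Head [d] started on the first letter, so it meets the left blank exactly when every other moving
    head is one cell to the left of its starting place. One step to the right then repairs all of
    them at once. *)
Lemma runs_rewind (T : finType) M (s0 : T) body d env s j pos :
    env d = 0 -> j <= size W -> pos =1 loop_pos d M env j ->
  exists2 pos', pos' =1 loop_pos d M env 1 &
    runs (e := Loop M s0 body) d j.+1 (inr (Some false, s)) pos s pos'.
Proof.
move=> envd; elim: j pos => [|j IH] pos jW hpos.
  exists (loop_pos d M env 1) => //; apply: (@runs_done _ _ _ _ _ _ (loop_move d M MoveRight)).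
    by rewrite /= hpos /loop_pos /moving eqxx envd.
    by move=> i; rewrite /loop_move; case: ifP.
  by move=> i; rewrite hpos /loop_move /loop_pos; case: ifP => //=; lia.
have [||pos' h1 h2] := IH (loop_pos d M env j); [exact: ltnW | by [] |].
exists pos' => //; apply: (@runs_more _ _ _ _ _ _ _ (loop_move d M MoveLeft)) h2.
  rewrite /= hpos /loop_pos /moving eqxx envd add0n /=.
  by have := cell_None j.+1; rewrite ltnNge jW /=; case: nth.
  by move=> i; rewrite hpos /loop_move /loop_pos; case: ifP => //=; lia.
by move=> i; rewrite hpos /loop_move /loop_pos; case: ifP => //=; lia.
Qed.

Lemma runs_eval A (e : expr A) d (env pos : nat -> nat) :
    (forall i, d <= i -> env i = 0) -> (forall i, pos i = (env i).+1) ->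
  exists t pos', [/\ t <= (cost e).[size W]%R, forall i, pos' i = (env i).+1
                   & runs d t (entry e) pos (eval W e d env) pos'].
Proof.
elim: e d env pos => {A} [A a|h|A B e IHe k IHk|T M s0 body IH] d env pos henv hpos.
- exists 1, pos; split=> //; first by rewrite hornerC.
  exact: (@runs_done _ _ _ _ _ _ (fun=> Stay)).
- exists 1, pos; split=> //; first by rewrite hornerC.
  by apply: (@runs_done _ _ _ _ _ _ (fun=> Stay)) => //=; rewrite hpos.
- have [t1 [pos1 [ht1 hp1 r1]]] := IHe d env pos henv hpos.
  have [t2 [pos2 [ht2 hp2 r2]]] := IHk (eval W e d env) d env pos1 henv hp1.
  exists (t1 + t2), pos2; split=> //; last exact: runs_bind r1 _ _ _ r2.
  rewrite /= hornerD horner_sum; apply: leq_add => //.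
  by apply: leq_trans ht2 _; rewrite (bigD1 (eval W e d env)) //= leq_addr.
- have envd : env d = 0 by apply: henv.
  set n := size W; set B := (\sum_(s : T) (cost (body s)).[n]%R)%N.
  (* Here [r] iterations are still to come and [n - r] are done. *)
  have key r s p : r <= n -> p =1 loop_pos d M env (n - r).+1 ->
    exists t pos', [/\ t <= r * (B + 2) + (n + 2), forall i, pos' i = (env i).+1
      & runs (e := Loop M s0 body) d t (inr (None, s)) p
      (foldl (fun s i => eval W (body s) d.+1 (shift d M i env)) s
        (iota (n - r) r)) pos'].
    elim: r s p => [|r IHr] s p hr hp.
      have [|p' hp' r'] := @runs_rewind T M s0 body d env s n (loop_pos d M env n) envd (leqnn _).
        by [].
      exists n.+2, p'; split=> /=.
      - by rewrite mul0n add0n addn2.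
      - by move=> i; rewrite hp' /loop_pos; case: ifP; rewrite ?addn1.
      apply: (@runs_more _ _ _ _ _ _ _ (loop_move d M MoveLeft)) r'.
        rewrite /= hp /loop_pos /moving eqxx envd add0n /= nth_default //.
        by rewrite size_map subn0.
        by move=> i; rewrite hp /loop_move /loop_pos subn0; case: ifP => //=; lia.
      by move=> i; rewrite hp /loop_move /loop_pos subn0; case: ifP => //=; lia.
    set c := n - r.+1.
    have hc : c < n by rewrite /c; lia.
    have sh i : loop_pos d M env c.+1 i = (shift d M c env i).+1.
      rewrite /loop_pos /shift /moving; case: eqP => [->|_] /=; first by rewrite envd.
      by case: ifP; rewrite ?addnS.
    have [|i|t1 [p1 [ht1 hp1 r1]]] := IH s d.+1 (shift d M c env) p.
    - move=> i hi; rewrite /shift gtn_eqF // (leq_gtF (ltnW hi)) /=.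
      by apply: henv; exact: ltnW.
    - by rewrite hp sh.
    have cr : (n - r) = c.+1 by rewrite /c; lia.
    have [||t2 [p2 [ht2 hp2 r2]]] := IHr (eval W (body s) d.+1 (shift d M c env))
      (loop_pos d M env c.+2); [lia | by rewrite cr |].
    exists (t1 + t2.+1).+1, p2; split=> //.
      have: t1 <= B by apply: leq_trans ht1 _; rewrite /B (bigD1 s) //= leq_addr.
      by move: ht2; rewrite mulSn; lia.
    apply: (@runs_more _ _ _ _ _ _ _ (fun=> Stay) p); last first.
      apply: (runs_body r1); rewrite /= -/c -cr.
      apply: (@runs_more _ _ _ _ _ _ _ (loop_move d M MoveRight)) r2 => //.
        by move=> i; rewrite /loop_move; case: ifP.
      by move=> i; rewrite hp1 -sh /loop_move /loop_pos; case: ifP => //=; lia.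
    - by [].
    - by [].
    rewrite /= hp /loop_pos /moving eqxx envd add0n /=.
    by have := cell_None c.+1; rewrite /= ltnS leqNgt hc; case: nth.
  have [|t [p' [ht hp' r]]] := key n s0 pos (leqnn n).
    by move=> i; rewrite hpos /loop_pos subnn addn1; case: ifP.
  exists t, p'; split=> //; last by move: r; rewrite subnn.
  by rewrite /= hornerD hornerM !hornerD horner_sum !hornerX !hornerC.
Qed.

End Runs.

Lemma trans_ext A (e : expr A) d q (s1 s2 : nat -> option Sigma) K :
    height d e <= K -> (forall h, h < K -> s1 h = s2 h) ->
  trans (e := e) d q s1 = trans d q s2.
Proof.
move=> hK hs; elim: e d q hK => {A} [A a|h|A B e IHe k IHk|T M s0 body IH] d q //=.
- by move=> hK; rewrite hs.
- rewrite geq_max => /andP[h1 /bigmax_leqP h2].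
  case: q => [q|[a q]]; first by rewrite IHe.
  by rewrite IHk // h2.
- rewrite geq_max => /andP[h1 /bigmax_leqP h2].
  case: q => [[s q]|[[[]|] s]] //; rewrite ?IH ?hs //.
  exact: h2.
Qed.

(** * Simulation by a Turing machine *)

Section Compile.

Variable e : expr bool.

Definition untag (s : option (Sigma + void)) : option Sigma :=
  if s is Some (inl a) then Some a else None.

(* State [inr false] copies the word onto all the tapes, [inr true] then rewinds them. *)
Definition compiled : machine Sigma :=
  @Machine Sigma (height 1 e) void ((ctrl e + bool) + bool)%type (inr false)
    (fun q => if q is inl (inr b) then Some b else None)
    (fun q syms =>
       match q with
       | inr false =>
           if syms ord0 is Some a then
             (inr false, fun=> (Some a, MoveRight))
           else (inr true, fun i => (syms i, MoveLeft))
       | inr true =>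
           if syms ord0 is Some a then
             (inr true, fun i => (syms i, MoveLeft))
           else (inl (inl (entry e)), fun i => (syms i, MoveRight))
       | inl (inl q) =>
           let: (r, m) := trans 1 q
             (fun h => if insub h is Some i then untag (syms i) else None) in
           (inl r, fun i => (syms i, m i))
       | inl (inr b) => (q, fun i => (syms i, Stay))
       end).

(** By truncated subtraction all cells left of position 0 read [f 0], which is blank for the
    contents [tcell W] used below. *)
Definition reads (A : Type) (f : nat -> option A) (p : nat) (tp : tape A) : Prop :=
  [/\ scanned tp = f p, forall k, nth None (lcells tp) k = f (p - k.+1)
    & forall k, nth None (rcells tp) k = f (p + k.+1)].

Lemma reads_write A (f f' : nat -> option A) p tp s m :
    reads f p tp -> f 0 = None -> (m = MoveLeft -> 0 < p) ->
    (forall i, f' i = if i == p then s else f i) ->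
  f' 0 = None -> reads f' (moved m p) (write_move (s, m) tp).
Proof.
case: tp => l x r [/= hx hl hr] f0 hm hf' f'0; case: m hm => /= hm.
- have {}hm := hm erefl; split=> /=.
  + rewrite -nth0 hl hf' subn1; case: eqP => // h; exfalso; lia.
  + move=> k; rewrite nth_behead hl hf'.
    case: eqP => [h|_]; first by exfalso; lia.
    by congr f; lia.
  + case=> [|k] /=; first by rewrite hf' addn1 prednK // eqxx.
    rewrite hr hf'; case: eqP => [h|_]; first by exfalso; lia.
    by congr f; lia.
- split=> /=.
  + by rewrite -nth0 hr hf' addn1 gtn_eqF.
  + case=> [|k] /=; first by rewrite subn1 hf' eqxx.
    rewrite hl subSS; have [p0|p0] := posnP p; first by rewrite p0 !sub0n f'0.
    by rewrite hf'; case: eqP => // h; exfalso; lia.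
  + move=> k; rewrite nth_behead hr hf'; case: eqP => [h|_]; first by exfalso; lia.
    by congr f; lia.
- split=> /=; first by rewrite hf' eqxx.
  + move=> k; rewrite hl hf'; case: eqP => // h.
    have p0 : p = 0 by lia.
    by have := hf' 0; rewrite f'0 p0 eqxx sub0n f0.
  + by move=> k; rewrite hr hf'; case: eqP => [h|//]; exfalso; lia.
Qed.

Lemma reads_tape_of (A : Type) (w : seq A) :
  reads (fun p => if p is p'.+1 then nth None (map Some w) p' else None) 1
    (tape_of w).
Proof.
case: w => [|a w]; split=> //= k; rewrite ?nth_nil //.
Qed.

Lemma reads_ext (A : Type) (f f' : nat -> option A) p tp :
  f =1 f' -> reads f p tp -> reads f' p tp.
Proof. by move=> h [h1 h2 h3]; split=> [|k|k]; rewrite -h. Qed.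

Definition tcell (W : seq Sigma) (p : nat) : option (Sigma + void) :=
  omap inl (cell W p).

Lemma untag_tcell W p : untag (tcell W p) = cell W p.
Proof. by rewrite /tcell; case: cell. Qed.

Lemma tcellE W p : tcell W p =
  if p is p'.+1 then nth None (map Some [seq inl a | a <- W]) p' else None.
Proof.
case: p => [|p] //=; rewrite /tcell /=.
by elim: W p => [|a s IH] [|p] //=; rewrite -IH.
Qed.

Lemma tcell_take W k p : k < size W ->
  tcell (take k.+1 W) p = if p == k.+1 then tcell W k.+1 else tcell (take k W) p.
Proof.
rewrite !tcellE; case: p => [|p] hk //=; rewrite eqSS !map_take.
have hk' : k < size [seq Some i | i <- [seq (inl a : Sigma + void) | a <- W]].
  by rewrite !size_map.
case: eqP => [->|/eqP hp]; first by rewrite nth_take.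
case: (ltngtP p k) hp => // hp _; first by rewrite !nth_take // ltnW.
by rewrite !nth_default ?size_takel // ltnW.
Qed.

Variable W : seq Sigma.

Notation M := compiled.
Notation n := (size W).

Definition cfg_reads (pos : nat -> nat) (c : config M) : Prop :=
  forall i : 'I_(ntapes M).+1, reads (tcell W) (pos i) (ctapes c i).

Lemma cfg_reads_step (pos pos' : nat -> nat) (m : nat -> head_move)
    (c : config M) (i : 'I_(ntapes M).+1) :
    reads (tcell W) (pos i) (ctapes c i) -> (m i = MoveLeft -> 0 < pos i) ->
    pos' i = moved (m i) (pos i) ->
  reads (tcell W) (pos' i)
    (write_move (scanned (ctapes c i), m i) (ctapes c i)).
Proof.
move=> hc hm ->; have [s0 _ _] := hc; apply: reads_write hc _ _ _ _ => //.
by move=> j; case: eqP => // ->.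
Qed.

Lemma tcell_Some p : p < n -> exists a, tcell W p.+1 = Some a.
Proof.
move=> hp; rewrite /tcell; have := cell_None W p.+1; rewrite ltnNge hp /=.
by case: nth => // a _; exists (inl a).
Qed.

Lemma tcell_n1 : tcell W n.+1 = None.
Proof. by apply/eqP; move: (cell_None W n.+1); rewrite ltnSn orbT /tcell; case: cell. Qed.

Lemma copy_phase k : k <= n ->
  let c := iter k (@step _ M) (init M W) in
  [/\ cstate c = inr false, reads (tcell W) k.+1 (ctapes c ord0)
    & forall i, i != ord0 -> reads (tcell (take k W)) k.+1 (ctapes c i)].
Proof.
elim: k => [|k IH] hk /=.
  split=> // [|i /negPf ->].
    by apply: reads_ext (reads_tape_of _) => p; rewrite tcellE.
  by apply: reads_ext (reads_tape_of [::]) => p; rewrite tcellE take0.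
have /= := IH (ltnW hk); case: (iter k _ _) => q tp /= [-> h0 hi].
rewrite /step /= ffunE; have [s0 _ _] := h0.
have [a ha] := tcell_Some hk; rewrite s0 ha; split=> //.
  apply: (@reads_write _ _ (tcell W) k.+1 _ (Some a) MoveRight h0) => // i.
  by case: eqP => // ->.
move=> i hi0; have /= [_ _ _] := hi i hi0.
apply: (@reads_write _ _ (tcell (take k.+1 W)) k.+1 _ (Some a) MoveRight (hi i hi0)) => // p.
by rewrite tcell_take // ha.
Qed.

(** All heads move in step here, so the input tape alone tells when the left blank is reached. *)
Lemma rewind_phase j (c : config M) : j <= n -> cstate c = inr true ->
    cfg_reads (fun=> j) c ->
  let c' := iter j.+1 (@step _ M) c in
  cstate c' = inl (inl (entry e)) /\ cfg_reads (fun=> 1) c'.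
Proof.
elim: j c => [|j IH] [q tp] hj /= -> hc.
  rewrite /step /= ffunE; have [-> _ _] := hc ord0; split=> //= i.
  rewrite /= ffunE; exact: (@cfg_reads_step (fun=> 0) (fun=> 1) (fun=> MoveRight) _ i (hc i)).
rewrite -iterS iterSr; apply: IH; first exact: ltnW.
  by rewrite /step /= ffunE; have [-> _ _] := hc ord0; have [a ->] := tcell_Some hj.
move=> i; rewrite /step /= ffunE; have [-> _ _] := hc ord0; have [a ->] := tcell_Some hj.
rewrite /= ffunE; exact: (@cfg_reads_step (fun=> j.+1) (fun=> j) (fun=> MoveLeft) _ i (hc i)).
Qed.

(** Copying takes [n] steps, turning round at the right blank takes one, and [n.+1] steps bring the
    heads back to the first letter. *)
Lemma start_phase :
  let c := iter (n + n.+2) (@step _ M) (init M W) in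
  cstate c = inl (inl (entry e)) /\ cfg_reads (fun=> 1) c.
Proof.
rewrite /= addnC iterD; have /= := copy_phase (leqnn n).
case: (iter n _ _) => q tp /= [-> h0 hi]; rewrite -iterS iterSr.
have hc : cfg_reads (fun=> n.+1) (Config (M := M) (inr false) tp).
  by move=> i /=; have [->//|i0] := eqVneq i ord0; have := hi i i0; rewrite take_size.
have [s0 _ _] := h0.
apply: rewind_phase => // [|i]; rewrite /step /= ffunE s0 tcell_n1 //= ffunE.
exact: (@cfg_reads_step (fun=> n.+1) (fun=> n) (fun=> MoveLeft) _ i (hc i)).
Qed.

Lemma run_phase t q pos a pos' (c : config M) :
    runs W 1 t q pos a pos' -> cstate c = inl (inl q) -> cfg_reads pos c ->
  cstate (iter t (@step _ M) c) = inl (inr a).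
Proof.
have syms (p : nat -> nat) (tp : 'I_(ntapes M).+1 -> _) h : (forall i : 'I_(ntapes M).+1, reads (tcell W) (p i) (tp i)) ->
    h < (height 1 e).+1 ->
    (if insub h is Some i then untag ([ffun i => scanned (tp i)] i) else None) = cell W (p h).
  move=> hr hh; rewrite insubT /= ffunE.
  by have [-> _ _] := hr (Ordinal hh); rewrite untag_tcell.
move=> hr; elim: hr c => {t q pos a pos'} [q pos a m pos' E hl hp|t q pos q1 m pos1 a pos' E hl hp _ IH] [q0 tp] /= -> hc.
  rewrite /step /= (trans_ext q (s2 := fun h => cell W (pos h)) (leqnSn _)) ?E //.
  by move=> h hh; apply: syms.
rewrite -iterS iterSr; apply: IH.
  rewrite /step /= (trans_ext q (s2 := fun h => cell W (pos h)) (leqnSn _)) ?E //.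
  by move=> h hh; apply: syms.
move=> i; rewrite /step /= (trans_ext q (s2 := fun h => cell W (pos h)) (leqnSn _)) ?E /=.
  by rewrite ffunE; exact: (@cfg_reads_step pos pos1 m _ i (hc i) (hl i) (hp i)).
by move=> h hh; apply: syms.
Qed.

End Compile.

Theorem inP_eval (e : expr bool) :
  inP (fun W => eval W e 1 (fun=> 0)).
Proof.
exists (compiled e), ('X + ('X + 2%:P) + cost e)%R => W.
exists (eval W e 1 (fun=> 0)) => //; rewrite /halts_within.
have [t [pos' [ht _ r]]] := @runs_eval W bool e 1 (fun=> 0) (fun=> 1) (fun _ _ => erefl) (fun=> erefl).
have /= [h1 h2] := start_phase e W.
have := run_phase r h1 h2; rewrite -iterD => h3.
have halted k (c : config (compiled e)) b : cstate c = inl (inr b) ->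
  cstate (iter k (@step _ (compiled e)) c) = inl (inr b).
  by move=> hc; elim: k => //= k; case: (iter k _ _) => q tp /= ->; rewrite /step.
set T := (_.[_])%R; have hT : t + (size W + (size W).+2) <= T.
  rewrite /T !hornerD !hornerX hornerC.
  rewrite [leqRHS](_ : _ = size W + (size W + 2) + (cost e).[size W]%R)%N //.
  by rewrite addn2 addnC leq_add2l.
by rewrite -(subnK hT) iterD (halted _ _ _ h3).
Qed.

End Language.

(** * Derived program constructs *)

Lemma foldl_iota_ind (T : Type) (P : nat -> T -> Prop) (f : T -> nat -> T) s0 n :
    P 0 s0 -> (forall k s, k < n -> P k s -> P k.+1 (f s k)) ->
  P n (foldl f s0 (iota 0 n)).
Proof.
move=> h0 h; have: forall k, k <= n -> P k (foldl f s0 (iota 0 k)).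
  elim=> [|k IH] hk //; rewrite -addn1 iotaD foldl_cat /= add0n addn1.
  by apply: h => //; apply: IH; exact: ltnW.
exact.
Qed.

Section Combinators.

Variable Sigma : finType.

(** For [is_one] this is the unary number that starts at [p], for [nonblank] the distance from [p]
    to the end of the word. Comparing numbers and comparing positions are thus the same program. *)
Definition runlen (P : pred (option Sigma)) (W : seq Sigma) (p : nat) : nat :=
  find (predC P) (drop p (map Some W)).

Definition order (a b : nat) : option bool :=
  if a < b then Some true else if b < a then Some false else None.

Lemma order_eq a b : (order a b == None) = (a == b).
Proof. by rewrite /order; case: ltngtP. Qed.

Lemma order_lt a b : (order a b == Some true) = (a < b).
Proof. by rewrite /order; case: ltngtP. Qed.

Lemma order_gt a b : (order a b == Some false) = (b < a).
Proof. by rewrite /order; case: ltngtP. Qed.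

(** The loop state [None] means undecided: both runs are still going on. Whichever run stops first
    is the shorter one. *)
Definition cmp (P : pred (option Sigma)) (h h' : nat) : expr Sigma (option bool) :=
  Bind (Loop [:: h; h'] (None : option (option bool)) (fun s =>
          if s is Some _ then Ret _ s else
          Bind (Read _ h) (fun l => Bind (Read _ h') (fun l' =>
            Ret _ (match P l, P l' with
                   | true, true => None
                   | false, true => Some (Some true)
                   | true, false => Some (Some false)
                   | false, false => Some None
                   end)))))
    (fun s => Ret _ (odflt None s)).

Lemma runlen_lt (P : pred (option Sigma)) W p k : P None = false -> k <= runlen P W p ->
  P (nth None (map Some W) (p + k)) = (k < runlen P W p).
Proof.
rewrite /runlen -nth_drop; set l := drop p _ => hP; rewrite leq_eqVlt => /orP[/eqP ->|hk].
  rewrite ltnn; have [h|h] := boolP (has (predC P) l).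
    by have /= /negPf := nth_find None h.
  by rewrite nth_default // hasNfind.
by rewrite hk; have /= /negbFE := before_find None hk.
Qed.

Lemma runlen_size P W p : runlen P W p <= size W - p.
Proof. by rewrite /runlen (leq_trans (find_size _ _)) // size_drop size_map. Qed.

Lemma eval_cmp (P : pred (option Sigma)) W h h' d env :
    P None = false -> h < d -> h' < d ->
  eval W (cmp P h h') d env = order (runlen P W (env h)) (runlen P W (env h')).
Proof.
move=> hP hd hd'; rewrite /cmp /=.
set a := runlen P W (env h); set b := runlen P W (env h').
(* The loop ends undecided only if both runs fill the whole word; the default value then correctly
   reports equality. *)
set X := foldl _ _ _; suff: X = if minn a b < size W then Some (order a b) else None.
  move=> ->; case: ifP => //= h1; have := runlen_size P W (env h).
  by have := runlen_size P W (env h'); rewrite /order -/a -/b; case: ltngtP => // *; exfalso; lia.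
pose Q k (s : option (option bool)) :=
  s = if minn a b < k then Some (order a b) else None.
apply: (foldl_iota_ind (P := Q)) => [|k s hk].
  by rewrite /Q ltn0.
rewrite /Q => ->; case: (ltnP _ k) => hm; first by rewrite ltnS ltnW.
rewrite /= /shift !ltn_eqF // hd hd' !inE !eqxx orbT /=.
rewrite !runlen_lt -/a -/b //; try lia.
have -> : (minn a b < k.+1) = ~~ ((k < a) && (k < b)) by lia.
by rewrite /order; case: (ltngtP a b); case: (ltnP k a); case: (ltnP k b) => //= *; exfalso; lia.
Qed.

Definition nonblank (l : option Sigma) : bool := l != None.

Lemma runlen_nonblank W p : runlen nonblank W p = size W - p.
Proof.
rewrite /runlen -map_drop hasNfind ?size_map ?size_drop //.
by apply/hasPn => x /mapP[y _ ->].
Qed.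

(** The earlier head has the longer rest of the word, whence [Some false]. Beyond the end all these
    distances are 0, so [env h] has to be inside the word. *)
Lemma eval_before W h h' d env : h < d -> h' < d -> env h < size W ->
  (eval W (cmp nonblank h h') d env == Some false) = (env h < env h').
Proof.
by move=> hd hd' hW; rewrite eval_cmp // order_gt !runlen_nonblank; lia.
Qed.

Variables (Q : finType) (q0 : Q) (next : Q -> Sigma -> Q) (act : Q -> Sigma -> bool).

Definition foreach (T : finType) (d : nat) (s0 : T) (body : T -> expr Sigma T) : expr Sigma T :=
  Bind (Loop [::] (q0, s0) (fun st =>
          Bind (Read _ d) (fun l =>
            if l is Some a then
              if act st.1 a then
                Bind (body st.2) (fun s => Ret _ (next st.1 a, s))
              else Ret _ (next st.1 a, st.2)
            else Ret _ st)))
    (fun st => Ret _ st.2).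

Fixpoint active (q : Q) (p : nat) (W : seq Sigma) : seq nat :=
  if W is a :: W' then
    (if act q a then [:: p] else [::]) ++ active (next q a) p.+1 W'
  else [::].

Lemma eval_foreach W (T : finType) d (s0 : T) body env :
  eval W (foreach d s0 body) d env =
  foldl (fun s p => eval W (body s) d.+1 (shift d [::] p env)) s0 (active q0 0 W).
Proof.
rewrite /foreach /=; set F := foldl _.
suff H W2 off q s : drop off W = W2 ->
   (F (q, s) (iota off (size W2))).2 =
   foldl (fun s p => eval W (body s) d.+1 (shift d [::] p env)) s (active q off W2).
  by rewrite -(H W 0) ?drop0.
elim: W2 off q s => [|a W2 IH] off q s hW //=.
have hoff : off < size W by rewrite ltnNge; apply/negP => h; rewrite drop_oversize in hW.
have := drop_nth a hoff; rewrite hW => -[h1 h2].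
rewrite {1}/shift eqxx (nth_map a) // -h1.
by case: ifP => _ /=; rewrite IH.
Qed.

End Combinators.

(** * Unary numbers in a pair of words and their grouping into triples *)

Notation letter := (option bool).
Notation prog := (expr letter).

Definition is_one (l : option letter) : bool := l == Some (Some true).

(** The two bits of the state say that a block starts here and that the separator has been
    passed. *)
Definition bl_next (q : bool * bool) (a : letter) : bool * bool :=
  if a is Some b then (~~ b, q.2) else (true, true).

Definition bl_act (part : bool) (q : bool * bool) (a : letter) : bool :=
  [&& a != None, q.1 & q.2 == part].

(* The blocks 1^v 0 of the first ([part = false]) or second ([part = true])
   component of a pair of words, given by their starting positions. *)
Definition blocks (part : bool) (W : seq letter) : seq nat :=
  active bl_next (bl_act part) (true, false) 0 W.

Definition for_block part (T : finType) d (s0 : T) body : prog T :=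
  foreach (true, false) bl_next (bl_act part) d s0 body.

Lemma active_ge (Sigma Q : finType) (nx : Q -> Sigma -> Q) act q p W x :
  x \in active nx act q p W -> p <= x.
Proof.
elim: W q p => //= a W IH q p; rewrite mem_cat => /orP[|/IH]; last exact: ltnW.
by case: ifP => //; rewrite inE => _ /eqP->.
Qed.

Lemma active_lt (Sigma Q : finType) (nx : Q -> Sigma -> Q) act q p W x :
  x \in active nx act q p W -> x < p + size W.
Proof.
elim: W q p => //= a W IH q p; rewrite mem_cat => /orP[|/IH]; last by rewrite addSnnS.
by case: ifP => //; rewrite inE => _ /eqP->; rewrite -addSnnS leq_addr.
Qed.

Lemma active_sorted (Sigma Q : finType) (nx : Q -> Sigma -> Q) act q p W :
  sorted ltn (active nx act q p W).
Proof.
elim: W q p => //= a W IH q p; case: ifP => _ //=.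
rewrite path_min_sorted ?IH //; apply/allP => x /active_ge; exact.
Qed.

(** A fresh head always starts at the beginning of the word, so the following block is found by a
    new search, as the first one beyond head [h]. *)
Definition next_block part h d (T : finType) (dflt : T) (e : prog T) : prog T :=
  Bind (for_block part d (None : option T) (fun s =>
          if s is Some _ then Ret _ s else
          Bind (cmp (@nonblank _) h d) (fun c =>
            if c == Some false then Bind e (fun r => Ret _ (Some r))
            else Ret _ None)))
    (fun r => Ret _ (odflt dflt r)).

Lemma eval_bind W (A B : finType) (e : prog A) (k : A -> prog B) d env :
  eval W (Bind e k) d env = eval W (k (eval W e d env)) d env.
Proof. by []. Qed.

Lemma eval_next_block W part h d (T : finType) (dflt : T) e env : h < d -> env h < size W ->
  eval W (next_block part h d dflt e) d env =
  if [seq x <- blocks part W | env h < x] is q :: _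
  then eval W e d.+1 (shift d [::] q env) else dflt.
Proof.
move=> hd hW; rewrite /next_block eval_bind eval_foreach -/(blocks part W) [LHS]/=.
set F := foldl _.
have F1 r l : F (Some r) l = Some r by elim: l => //= x l ->.
elim: (blocks part W) => //= x l IH.
have E : shift d [::] x env h = env h by rewrite /shift ltn_eqF // andbF.
rewrite eval_before ?E ?(leqW hd) //.
rewrite [in X in _ < X]/shift eqxx.
by case: ifP => _ /=; rewrite ?F1.
Qed.

Definition triple3 (T : Type) := (T * T * T)%type.

Fixpoint grp3 (T : Type) (l : seq T) : seq (triple3 T) :=
  if l is x :: y :: z :: l' then (x, y, z) :: grp3 l' else [::].

Lemma grp3_ind (T : Type) (P : seq T -> Prop) :
  P [::] -> (forall x, P [:: x]) -> (forall x y, P [:: x; y]) ->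
  (forall x y z l, P l -> P [:: x, y, z & l]) -> forall l, P l.
Proof.
move=> h0 h1 h2 h3 l; have [n] := ubnP (size l).
elim: n l => // n IH [|x [|y [|z l]]] //= hl; apply: h3; apply: IH; lia.
Qed.

Definition map3 (T U : Type) (f : T -> U) (t : triple3 T) : triple3 U :=
  (f t.1.1, f t.1.2, f t.2).

Lemma grp3_map (T U : Type) (f : T -> U) l :
  grp3 (map f l) = map (map3 f) (grp3 l).
Proof. by elim/grp3_ind: l => //= x y z l ->. Qed.

(* The counter starts one step behind in the first component, whose first
   block is not part of a triple. *)
Definition for_triple part (T : finType) d (s0 : T) (body : T -> prog T) : prog T :=
  Bind (for_block part d (if part then None else Some true, s0) (fun cs =>
      if cs.1 is Some b then Ret _ (if b then None else Some true, cs.2)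
      else Bind (next_block part d d.+1 cs.2
                  (next_block part d.+1 d.+2 cs.2 (body cs.2)))
             (fun s => Ret _ (Some false, s))))
    (fun cs => Ret _ cs.2).

Definition tblocks part W : seq (triple3 nat) :=
  grp3 (if part then blocks part W else behead (blocks part W)).

Definition shift3 d (t : triple3 nat) (env : nat -> nat) : nat -> nat :=
  shift d.+2 [::] t.2 (shift d.+1 [::] t.1.2 (shift d [::] t.1.1 env)).

Lemma filter_after (l1 l2 : seq nat) x : sorted ltn (l1 ++ x :: l2) ->
  [seq y <- l1 ++ x :: l2 | x < y] = l2.
Proof.
rewrite sorted_pairwise; last exact: ltn_trans.
rewrite pairwise_cat pairwise_cons => /and3P[/allrelP h1 _ /andP[/allP h2 _]].
rewrite filter_cat /= ltnn (_ : [seq y <- l1 | x < y] = [::]).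
  by apply/all_filterP/allP => y /h2.
apply/eqP; rewrite -(negbK (_ == _)) -has_filter; apply/hasPn => y hy.
by rewrite -leqNgt; apply/ltnW/(h1 y x hy (mem_head _ _)).
Qed.

Lemma eval_for_triple W part (T : finType) d (s0 : T) body env :
  eval W (for_triple part d s0 body) d env =
  foldl (fun s t => eval W (body s) d.+3 (shift3 d t env)) s0 (tblocks part W).
Proof.
rewrite /for_triple eval_bind eval_foreach -/(blocks part W) [LHS]/=.
set F := foldl _.
have sb : sorted ltn (blocks part W) by apply: active_sorted.
have lb x : x \in blocks part W -> x < size W by apply: active_lt.
suff H l1 l r : blocks part W = l1 ++ l -> (F (None, r) l).2 =
    foldl (fun s t => eval W (body s) d.+3 (shift3 d t env)) r (grp3 l).
  rewrite /tblocks; case: (part) H (H [::] (blocks part W)) => H H0; first exact: H0.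
  by case: blocks H => //= x l H; rewrite (H [:: x]).
have sh h x (env' : nat -> nat) : shift h [::] x env' h = x by rewrite /shift eqxx.
have F0 s x m : F (None, s) (x :: m) = F (Some false,
    eval W (next_block part d d.+1 s (next_block part d.+1 d.+2 s (body s)))
      d.+1 (shift d [::] x env)) m by [].
have F1 s x m : F (Some false, s) (x :: m) = F (Some true, s) m by [].
have F2 s x m : F (Some true, s) (x :: m) = F (None, s) m by [].
have nx h d' x (t : T) e' env' m1 m2 : h < d' -> env' h = x ->
    blocks part W = m1 ++ x :: m2 ->
    eval W (next_block part h d' t e') d' env' =
    if m2 is y :: _ then eval W e' d'.+1 (shift d' [::] y env') else t.
  move=> hh hx hb; rewrite eval_next_block // ?hx ?lb ?hb ?mem_cat ?mem_head ?orbT //.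
  by rewrite filter_after // -hb.
elim/grp3_ind: l r l1 => [//|x|x y|x y z l IH] r l1 hl.
- by rewrite F0 (nx _ _ _ _ _ _ _ _ _ (sh _ _ _) hl).
- rewrite F0 F1 (nx _ _ _ _ _ _ _ _ _ (sh _ _ _) hl) //.
  by rewrite (nx _ _ y _ _ _ (rcons l1 x) [::]) ?sh // cat_rcons.
- rewrite F0 F1 F2 (nx _ _ _ _ _ _ _ _ _ (sh _ _ _) hl) //.
  rewrite (nx _ _ y _ _ _ (rcons l1 x) (z :: l)) ?sh // ?cat_rcons //.
  by rewrite (IH _ (l1 ++ [:: x; y; z])) // hl -catA.
Qed.

(** An unfinished last block counts too, so that every word, in particular every certificate,
    decodes to a list of numbers. *)
Fixpoint nums (ps : bool) (w : seq bool) : seq nat :=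
  if w is b :: w' then
    (if ps then [:: find negb w] else [::]) ++ nums (~~ b) w'
  else [::].

Definition val_at (W : seq letter) (p : nat) : nat := runlen is_one W p.

Lemma runlen_prefix W p (w : seq bool) (v : seq letter) :
  drop p W = map Some w ++ v -> ohead v != Some (Some true) ->
  val_at W p = find negb w.
Proof.
move=> h hv; rewrite /val_at /runlen -map_drop h.
elim: w {h} => [|[] w IH] //=; last by rewrite IH.
by case: v hv => //= a v; rewrite /is_one; case: eqP.
Qed.

(** The flag [ps'] reached after [w] may stay unspecified: it is followed by the separator, which
    resets it, or by nothing. *)
Lemma map_active part inu ps p W (w : seq bool) (v : seq letter) :
    drop p W = map Some w ++ v -> ohead v != Some (Some true) ->
  exists ps', [seq val_at W x | x <-
      active bl_next (bl_act part) (ps, inu) p (map Some w ++ v)] =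
    (if inu == part then nums ps w else [::]) ++
    [seq val_at W x | x <- active bl_next (bl_act part) (ps', inu) (p + size w) v].
Proof.
move=> + hv; elim: w ps p => [|b w IH] ps p hp.
  by exists ps; rewrite addn0; case: eqP.
have hp' : drop p.+1 W = map Some w ++ v by rewrite -add1n -drop_drop drop1 hp.
have [ps' E] := IH (~~ b) p.+1 hp'; exists ps'.
rewrite [size _]/= -addSnnS map_cat -/(map _ _) E /= /bl_act /=.
case: eqP => _ /=; last by rewrite andbF.
by case: ps => //=; rewrite (runlen_prefix hp hv).
Qed.

Lemma blocks_nums part w u :
  [seq val_at (word_pair w u) x | x <- blocks part (word_pair w u)] =
  nums true (if part then u else w).
Proof.
rewrite /blocks; set W := word_pair w u.
have [|//|ps E] := @map_active part false true 0 W w (None :: map Some u).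
  by rewrite drop0.
rewrite {}E; have [|//|ps' E] := @map_active part true true (size w).+1 W u [::].
  by rewrite cats0 /W /word_pair -add1n -drop_drop drop_size_cat ?size_map //= drop0.
rewrite cats0 in E; rewrite add0n /= E /= cats0.
by case: (part); rewrite ?cats0.
Qed.

(** * The verifier *)

Lemma eq_in_foldl (T R : eqType) (f g : R -> T -> R) l s :
  (forall t, t \in l -> forall s, f s t = g s t) -> foldl f s l = foldl g s l.
Proof.
elim: l s => //= t l IH s h; rewrite h ?mem_head // IH // => x xl.
by apply: h; rewrite inE xl orbT.
Qed.

Lemma foldl_map (T U R : Type) (f : T -> U) (g : R -> U -> R) s l :
  foldl g s (map f l) = foldl (fun s t => g s (f t)) s l.
Proof. by elim: l s => //= t l IH s. Qed.

Lemma foldl_and (T : Type) (f : T -> bool) b l :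
  foldl (fun s t => s && f t) b l = b && all f l.
Proof. by elim: l b => [|t l IH] b /=; rewrite ?andbT // IH andbA. Qed.

Lemma foldl_or (T : Type) (f : T -> bool) b l :
  foldl (fun s t => s || f t) b l = b || has f l.
Proof. by elim: l b => [|t l IH] b /=; rewrite ?orbF // IH orbA. Qed.

Lemma foldl_xor (T : Type) (f : T -> bool) b l :
  foldl (fun s t => s (+) f t) b l = b (+) odd (count f l).
Proof.
by elim: l b => [|t l IH] b /=; rewrite ?addbF // IH oddD oddb addbA.
Qed.

Section Scan.

Variables (Sigma Q : finType) (q0 : Q) (next : Q -> Sigma -> Q).

Definition scan d : expr Sigma Q :=
  Loop [::] q0 (fun q => Bind (Read _ d) (fun l =>
    Ret _ (if l is Some a then next q a else q))).

Lemma eval_scan W d env : eval W (scan d) d env = foldl next q0 W.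
Proof.
rewrite /scan /=; set F := foldl _.
suff H W2 off q : drop off W = W2 -> F q (iota off (size W2)) = foldl next q W2.
  by rewrite -(H W 0) ?drop0.
elim: W2 off q => [|a W2 IH] off q hW //=.
have hoff : off < size W by rewrite ltnNge; apply/negP => h; rewrite drop_oversize in hW.
have := drop_nth a hoff; rewrite hW => -[h1 h2].
by rewrite {1}/shift eqxx (nth_map a) // -h1 IH.
Qed.

End Scan.

(* A triple whose first entry is at least [N] marks the end of a tree. *)
Section Spec.

Variable N : nat.
Implicit Types (t : triple3 nat) (I C cur : seq (triple3 nat)).

Definition sep t := N <= t.1.1.

Definition mem3 (x : nat) t := [|| x == t.1.1, x == t.1.2 | x == t.2].

(** Only an inclusion, but for triples with three distinct entries it is equality of the underlying
    sets. *)
Definition same t t' := [&& mem3 t.1.1 t', mem3 t.1.2 t' & mem3 t.2 t'].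

Definition placed cur : seq nat := flatten [seq [:: t.1.2; t.2] | t <- cur].

(** Descending, because the suffixes of the header 1^N 0 that start at positions 1, 2, ... code the
    numbers N - 1, N - 2, ...: the header itself supplies all vertices other than the root 0. *)
Fixpoint downto (n : nat) : seq nat := if n is n'.+1 then n :: downto n' else [::].

Definition covers cur := all [in placed cur] (downto N.-1).

Definition admissible I cur t :=
  [&& t.1.2 < N, t.2 < N, t.1.2 != t.2, t.1.2 != 0, t.2 != 0,
      (t.1.1 == 0) || (t.1.1 \in placed cur),
      t.1.2 \notin placed cur, t.2 \notin placed cur & has (same t) I].

(** The change of the parity [bpar] when [t] is attached. Larger vertices are counted because the
    root 0, which [placed] omits, is never among them. *)
Definition tpar cur t : bool :=
  odd (count (fun x => t.1.2 < x) (placed cur)) (+)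
  odd (count (fun x => t.2 < x) (placed cur)) (+)
  (t.1.2 < t.1.1) (+) (t.2 < t.1.1).

(* Everything is fine so far; parity of the inversions; parity of the number of
   completed trees; the last triple was an end mark. *)
Definition status := (bool * bool * bool * bool)%type.

Definition vstep I (cs : seq (triple3 nat) * status) t :=
  let: (cur, (ok, pf, pe, last)) := cs in
  if sep t then ([::], (ok && covers cur, pf, ~~ pe, true))
  else (rcons cur t, (ok && admissible I cur t, pf (+) tpar cur t, pe, false)).

Definition trees_ok I C :=
  let: (ok, pf, pe, last) := (foldl (vstep I) ([::], (true, false, false, true)) C).2 in
  [&& ok, pf, ~~ pe & last].

Definition even_ok I C :=
  all (fun t => ~~ odd (count (fun t' => ~~ sep t' && same t t') C)) I.

Definition cert_ok I C := even_ok I C && trees_ok I C.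

Definition input_triple t :=
  [&& t.1.1 < N, t.1.2 < N, t.2 < N, t.1.1 != t.1.2, t.1.1 != t.2 & t.1.2 != t.2].

Definition cur_step cur t := if sep t then [::] else rcons cur t.

Definition current C := foldl cur_step [::] C.

(** A program cannot store the triples of the tree in progress. Instead, a fold over them is
    computed by a fold over everything read so far that restarts at each end mark. *)
Lemma current_foldl (T : Type) (g : T -> triple3 nat -> T) s0 C :
  foldl (fun s t => if sep t then s0 else g s t) s0 C = foldl g s0 (current C).
Proof.
elim/last_ind: C => //= C t IH; rewrite /current !foldl_rcons IH /cur_step.
by case: ifP => //; rewrite foldl_rcons.
Qed.

Lemma vstep_current I st C :
  (foldl (vstep I) ([::], st) C).1 = current C.
Proof.
elim/last_ind: C => //= C t IH; rewrite /current !foldl_rcons -/(current C) -IH.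
case: foldl => cur [[[ok pf] pe] last] /=; rewrite /cur_step; by case: ifP.
Qed.

End Spec.

(** * The checks as programs *)

Section Programs.

Definition pand (e1 e2 : prog bool) : prog bool :=
  Bind e1 (fun a => Bind e2 (fun b => Ret _ (a && b))).
Definition por (e1 e2 : prog bool) : prog bool :=
  Bind e1 (fun a => Bind e2 (fun b => Ret _ (a || b))).
Definition pxor (e1 e2 : prog bool) : prog bool :=
  Bind e1 (fun a => Bind e2 (fun b => Ret _ (a (+) b))).
Definition pneg (e : prog bool) : prog bool := Bind e (fun a => Ret _ (~~ a)).
Definition plt h h' : prog bool := Bind (cmp is_one h h') (fun r => Ret _ (r == Some true)).
Definition peq h h' : prog bool := Bind (cmp is_one h h') (fun r => Ret _ (r == None)).
Definition pbefore h h' : prog bool :=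
  Bind (cmp (@nonblank _) h h') (fun r => Ret _ (r == Some false)).
Definition pzero h : prog bool := Bind (Read _ h) (fun l => Ret _ (~~ is_one l)).

(* The triple [j] is scanned by the heads [j], [j.+1] and [j.+2]. *)
Definition psep j := pneg (plt j 0).
Definition pmem h j := por (peq h j) (por (peq h j.+1) (peq h j.+2)).
Definition psame i j := pand (pmem i j) (pand (pmem i.+1 j) (pmem i.+2 j)).

Definition for_current (T : finType) d j (s0 : T) (body : T -> prog T) : prog T :=
  for_triple true d s0 (fun s =>
    Bind (pbefore d j) (fun r =>
      if r then Bind (psep d) (fun z => if z then Ret _ s0 else body s)
      else Ret _ s)).

(** [None] is the state at the first letter, which is skipped since the number starting there is
    [N]; [Some false] means that the header is over. *)
Definition hd_next (q : option bool) (a : letter) : option bool :=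
  if q is Some false then q else Some (a == Some true).
Definition hd_act (q : option bool) (a : letter) : bool :=
  (q == Some true) && (a == Some true).

Definition pcovers : prog bool :=
  foreach None hd_next hd_act 4 true (fun s =>
    pand (Ret _ s)
      (for_current 5 1 false (fun s => por (Ret _ s) (por (peq 6 4) (peq 7 4))))).

Definition pscan : prog (bool * bool * bool * bool)%type :=
  for_current 4 1 (false, false, false, false) (fun s =>
    let: (ain, bin, cin, par) := s in
    Bind (por (Ret _ ain) (por (peq 1 5) (peq 1 6))) (fun ain =>
    Bind (por (Ret _ bin) (por (peq 2 5) (peq 2 6))) (fun bin =>
    Bind (por (Ret _ cin) (por (peq 3 5) (peq 3 6))) (fun cin =>
    Bind (pxor (Ret _ par) (pxor (pxor (plt 2 5) (plt 2 6)) (pxor (plt 3 5) (plt 3 6))))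
      (fun par => Ret _ (ain, bin, cin, par)))))).

Definition pinput : prog bool :=
  for_triple false 4 false (fun s => por (Ret _ s) (psame 1 4)).

Definition pstep (st : status) : prog status :=
  let: (ok, pf, pe, last) := st in
  Bind (psep 1) (fun z =>
    if z then Bind pcovers (fun r => Ret _ (ok && r, pf, ~~ pe, true))
    else Bind pscan (fun s => let: (ain, bin, cin, par) := s in
      Bind (pand (plt 2 0) (pand (plt 3 0) (pand (pneg (peq 2 3))
           (pand (pneg (pzero 2)) (pand (pneg (pzero 3))
           (pand (por (pzero 1) (Ret _ ain)) (pand (Ret _ (~~ bin))
           (pand (Ret _ (~~ cin)) pinput))))))))
      (fun r => Bind (pxor (pxor (Ret _ par) (plt 2 1)) (plt 3 1))
      (fun p => Ret _ (ok && r, pf (+) p, pe, false))))).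

Definition ptrees : prog bool :=
  Bind (for_triple true 1 (true, false, false, true) pstep)
    (fun st => let: (ok, pf, pe, last) := st in
               Ret _ [&& ok, pf, ~~ pe & last]).

Definition peven : prog bool :=
  for_triple false 1 true (fun s => pand (Ret _ s) (pneg
    (for_triple true 4 false (fun p =>
       pxor (Ret _ p) (pand (pneg (psep 4)) (psame 1 4)))))).

(* The state is the verdict once the separator has been met. *)
Definition shape_next (q : bool * 'I_3 + bool) (a : letter) : bool * 'I_3 + bool :=
  match q, a with
  | inl (_, k), Some b => inl (~~ b, if b then k else ordS k)
  | inl (p, k), None => inr (p && (k == 1 :> nat))
  | inr _, _ => q
  end.

Definition pshape : prog bool :=
  Bind (scan (inl (false, ord0) : bool * 'I_3 + bool) shape_next 1)
    (fun q => Ret _ (if q is inr r then r else false)).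

Definition pinputs : prog bool :=
  for_triple false 1 true (fun s => pand (Ret _ s)
    (pand (plt 1 0) (pand (plt 2 0) (pand (plt 3 0) (pand (pneg (peq 1 2))
       (pand (pneg (peq 1 3)) (pneg (peq 2 3)))))))).

(** A word that encodes no 3-graph belongs to the complement, so it is accepted with any
    certificate. *)
Definition verifier : prog bool :=
  por (pneg (pand pshape pinputs)) (pand peven ptrees).

(** There is one block for the header and there are three for each triple, all closed by a zero;
    hence the number of zeros is 1 modulo 3. *)
Definition shape_ok (w : seq bool) : bool :=
  ~~ last true w && (count negb w %% 3 == 1).

(** * Correctness of the programs *)

Section Eval.

Variables w u : seq bool.
Let W := word_pair w u.
Let N := head 0 (nums true w).
Let I := grp3 (behead (nums true w)).
Let C := grp3 (nums true u).

Implicit Types (env : nat -> nat).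

Lemma eval_pand e1 e2 d env :
  eval W (pand e1 e2) d env = eval W e1 d env && eval W e2 d env.
Proof. by []. Qed.
Lemma eval_por e1 e2 d env :
  eval W (por e1 e2) d env = eval W e1 d env || eval W e2 d env.
Proof. by []. Qed.
Lemma eval_pxor e1 e2 d env :
  eval W (pxor e1 e2) d env = eval W e1 d env (+) eval W e2 d env.
Proof. by []. Qed.
Lemma eval_pneg e d env : eval W (pneg e) d env = ~~ eval W e d env.
Proof. by []. Qed.
Lemma eval_ret (A : finType) (a : A) d env : eval W (Ret _ a) d env = a.
Proof. by []. Qed.

Lemma eval_plt h h' d env : h < d -> h' < d ->
  eval W (plt h h') d env = (val_at W (env h) < val_at W (env h')).
Proof. by move=> hd hd'; rewrite /plt eval_bind eval_ret eval_cmp // order_lt. Qed.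

Lemma eval_peq h h' d env : h < d -> h' < d ->
  eval W (peq h h') d env = (val_at W (env h) == val_at W (env h')).
Proof. by move=> hd hd'; rewrite /peq eval_bind eval_ret eval_cmp // order_eq. Qed.

Lemma eval_pzero h d env :
  eval W (pzero h) d env = (val_at W (env h) == 0).
Proof.
rewrite /pzero /=; have := @runlen_lt _ is_one W (env h) 0 erefl isT.
by rewrite addn0 => ->; rewrite lt0n negbK.
Qed.

(** Programs are started with [d = 1] for this reason: head 0 rests on the header and makes [N]
    available to all comparisons. *)
Lemma val_at0 : val_at W 0 = N.
Proof.
rewrite /N (@runlen_prefix W 0 w (None :: map Some u)) ?drop0 //.
by case: (w).
Qed.

Definition values_at env j : triple3 nat :=
  (val_at W (env j), val_at W (env j.+1), val_at W (env j.+2)).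

Lemma eval_psep j d env : 0 < d -> j < d -> env 0 = 0 ->
  eval W (psep j) d env = sep N (values_at env j).
Proof. by move=> d0 jd e0; rewrite eval_pneg eval_plt // e0 val_at0 -leqNgt. Qed.

Lemma eval_psame i j d env : i.+2 < d -> j.+2 < d ->
  eval W (psame i j) d env = same (values_at env i) (values_at env j).
Proof.
move=> hi hj; rewrite /psame !eval_pand /pmem !eval_por !eval_peq //; lia.
Qed.

Lemma tblocks_vals part :
  map (map3 (val_at W)) (tblocks part W) = if part then C else I.
Proof.
rewrite /tblocks -grp3_map; case: part.
  by rewrite (blocks_nums true w u).
by rewrite -behead_map (blocks_nums false w u).
Qed.

Lemma shift3_low d t env h : h < d -> shift3 d t env h = env h.
Proof. by move=> hd; rewrite /shift3 /shift !andbF !ltn_eqF //; lia. Qed.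

Lemma values_shift3_low d t env j : j.+2 < d -> values_at (shift3 d t env) j = values_at env j.
Proof. by move=> jd; rewrite /values_at !shift3_low //; lia. Qed.

Lemma shift3_1 d t env : shift3 d t env d = t.1.1.
Proof. by rewrite /shift3 /shift eqxx !andbF !ltn_eqF. Qed.

Lemma shift3_2 d t env : shift3 d t env d.+1 = t.1.2.
Proof. by rewrite /shift3 /shift eqxx !andbF !ltn_eqF. Qed.

Lemma shift3_3 d t env : shift3 d t env d.+2 = t.2.
Proof. by rewrite /shift3 /shift eqxx. Qed.

Lemma values_shift3 d t env : values_at (shift3 d t env) d = map3 (val_at W) t.
Proof.
by rewrite /values_at shift3_1 shift3_2 shift3_3.
Qed.

Lemma grp3_subseq (l : seq nat) : subseq [seq t.1.1 | t <- grp3 l] l.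
Proof.
elim/grp3_ind: l => //= x y z l IH; rewrite eqxx.
exact: subseq_trans IH (subseq_trans (subseq_cons _ z) (subseq_cons _ y)).
Qed.

Lemma tblocks_sorted part : sorted ltn [seq t.1.1 | t <- tblocks part W].
Proof.
have sb : sorted ltn (blocks part W) by apply: active_sorted.
apply: (subseq_sorted ltn_trans (grp3_subseq _)).
by case: (part) sb => //; case: blocks => //= x l /path_sorted.
Qed.

Lemma tblocks_lt part t : t \in tblocks part W -> t.1.1 < size W.
Proof.
move=> /(map_f (fun t => t.1.1)) /(mem_subseq (grp3_subseq _)) h.
suff: t.1.1 \in blocks part W by apply: active_lt.
by case: (part) h => //; apply: mem_behead.
Qed.

(** The first blocks of the triples are met in increasing positions, so the triples lying before
    head [j] are exactly those of the prefix [pre]. *)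
Lemma eval_for_current (T : finType) d j (s0 : T) body g env pre tj post :
    0 < j < d -> env 0 = 0 -> env j = tj.1.1 ->
    tblocks true W = pre ++ tj :: post ->
    (forall s t, eval W (body s) d.+3 (shift3 d t env) = g s (map3 (val_at W) t)) ->
  eval W (for_current d j s0 body) d env =
    foldl g s0 (current N (map (map3 (val_at W)) pre)).
Proof.
move=> /andP[j0 jd] e0 ej hpre hg; rewrite -current_foldl eval_for_triple.
rewrite [in RHS]foldl_map.
have : sorted ltn [seq t.1.1 | t <- pre ++ tj :: post] by rewrite -hpre tblocks_sorted.
rewrite map_cat sorted_pairwise; last exact: ltn_trans.
rewrite pairwise_cat map_cons pairwise_cons => /and3P[/allrelP h1 _ /andP[/allP h2 _]].
have hlt t : t \in tblocks true W -> t.1.1 < size W by apply: tblocks_lt.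
set F := fun s t => _; set G := fun s t => _.
have hF s t : t \in tblocks true W -> F s t =
    if t.1.1 < tj.1.1 then G s t else s.
  move=> ht; rewrite /F eval_bind /pbefore eval_bind eval_ret.
  have ed := shift3_1 d t env.
  rewrite eval_before ?ed ?hlt //; [|lia|lia].
  rewrite shift3_low // ej; case: ifP => // _.
  rewrite eval_bind eval_psep ?shift3_low //; [|lia|lia].
  by rewrite values_shift3 /G; case: ifP => //; rewrite hg.
have hpost s l : {subset l <= tj :: post} -> foldl F s l = s.
  elim: l s => //= t l IH s hl; rewrite hF; last first.
    by rewrite hpre mem_cat hl ?mem_head ?orbT.
  rewrite ifF ?IH // => [x xl|]; first by rewrite hl // inE xl orbT.
  apply/negbTE; rewrite -leqNgt; have := hl t (mem_head _ _).
  by rewrite inE => /predU1P[->//|ht]; apply/ltnW/h2/map_f.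
rewrite hpre foldl_cat hpost //; apply: eq_in_foldl => t ht s.
rewrite hF ?hpre ?mem_cat ?ht // ifT //.
by apply: h1; [apply: map_f | rewrite mem_head].
Qed.

Lemma map_active_header :
  [seq val_at W p | p <- active hd_next hd_act None 0 W] = downto N.-1.
Proof.
have stop q l : active hd_next hd_act (Some false) q l = [::].
  by elim: l q => //= a l IH q; rewrite IH.
have key v p : drop p W = map Some v ++ None :: map Some u ->
    [seq val_at W p | p <- active hd_next hd_act (Some true) p (drop p W)] =
    downto (find negb v).
  move=> hp; rewrite hp; elim: v p hp => [|[] v IH] p hp /=; rewrite ?stop //.
  rewrite IH; last by rewrite -add1n -drop_drop hp /= drop0.
  by rewrite (@runlen_prefix W p (true :: v) _ hp).
have := key (behead w) 1; rewrite /N /W /word_pair drop1.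
case: (w) => [|[] v] /=; rewrite ?stop // => -> //.
Qed.

Section Current.

Variables (env : nat -> nat) (pre post : seq (triple3 nat)) (tj : triple3 nat).
Hypotheses (e0 : env 0 = 0) (e1 : env 1 = tj.1.1)
  (hpre : tblocks true W = pre ++ tj :: post).

Let cur := current N (map (map3 (val_at W)) pre).

Lemma foldl_placed (x : nat) b l :
  foldl (fun s t => s || ((t.1.2 == x) || (t.2 == x))) b l = b || (x \in placed l).
Proof.
rewrite foldl_or; congr (_ || _); rewrite /placed.
by elim: l => //= t l IH; rewrite !inE IH orbA (eq_sym x) (eq_sym x t.2).
Qed.

Lemma eval_pscan : let t := values_at env 1 in
  eval W pscan 4 env = (t.1.1 \in placed cur, t.1.2 \in placed cur, t.2 \in placed cur,
    odd (count (fun x => t.1.2 < x) (placed cur)) (+)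
    odd (count (fun x => t.2 < x) (placed cur))).
Proof.
move=> t; rewrite /pscan.
pose g (s : bool * bool * bool * bool) (x : triple3 nat) := let: (ain, bin, cin, par) := s in
  (ain || ((t.1.1 == x.1.2) || (t.1.1 == x.2)), bin || ((t.1.2 == x.1.2) || (t.1.2 == x.2)),
   cin || ((t.2 == x.1.2) || (t.2 == x.2)),
   par (+) (((t.1.2 < x.1.2) (+) (t.1.2 < x.2)) (+) ((t.2 < x.1.2) (+) (t.2 < x.2)))).
rewrite (@eval_for_current _ 4 1 _ _ g env pre tj post) //.
  rewrite -/cur; elim/last_ind: cur => //= l x IH.
  rewrite foldl_rcons IH /g /placed map_rcons -cats1 flatten_cat /= !mem_cat !inE.
  rewrite !count_cat /= !addn0 !oddD !oddb; congr (_, _, _, _).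
  by do 4 case: (_ < _); do 2 case: odd.
move=> [[[ain bin] cin] par] x.
set env' := shift3 4 x env.
rewrite [LHS](_ : _ =
  (ain || (eval W (peq 1 5) 7 env' || eval W (peq 1 6) 7 env'),
   bin || (eval W (peq 2 5) 7 env' || eval W (peq 2 6) 7 env'),
   cin || (eval W (peq 3 5) 7 env' || eval W (peq 3 6) 7 env'),
   par (+) ((eval W (plt 2 5) 7 env' (+) eval W (plt 2 6) 7 env') (+)
            (eval W (plt 3 5) 7 env' (+) eval W (plt 3 6) 7 env')))) //.
by rewrite !eval_peq // !eval_plt.
Qed.

Lemma eval_pcovers : eval W pcovers 4 env = covers N cur.
Proof.
rewrite /pcovers eval_foreach /covers -map_active_header all_map.
rewrite -[RHS]andTb -foldl_and; apply: eq_in_foldl => p _ s.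
rewrite eval_pand eval_ret; congr (_ && _).
pose g s (x : triple3 nat) := s || ((x.1.2 == val_at W p) || (x.2 == val_at W p)).
rewrite (@eval_for_current _ 5 1 _ _ g _ pre tj post) // => [|b t].
  by rewrite foldl_placed.
by rewrite !eval_por eval_ret !eval_peq // (shift3_2 5) (shift3_3 5).
Qed.

Lemma eval_pinput : eval W pinput 4 env = has (same (values_at env 1)) I.
Proof.
rewrite /pinput eval_for_triple -(tblocks_vals false) has_map.
rewrite -[RHS]orFb -foldl_or; apply: eq_in_foldl => t _ s.
by rewrite eval_por eval_ret eval_psame // values_shift3_low // values_shift3.
Qed.

Lemma eval_pstep st : eval W (pstep st) 4 env = (vstep N I (cur, st) (values_at env 1)).2.
Proof.
case: st => [[[ok pf] pe] last]; rewrite /pstep eval_bind eval_psep //= -/(vstep _ _ _).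
case: ifP => hs; first by rewrite eval_bind eval_pcovers.
rewrite eval_bind eval_pscan.
rewrite [LHS](_ : _ = (ok && [&& eval W (plt 2 0) 4 env, eval W (plt 3 0) 4 env,
    ~~ eval W (peq 2 3) 4 env, ~~ eval W (pzero 2) 4 env, ~~ eval W (pzero 3) 4 env,
    eval W (pzero 1) 4 env || ((values_at env 1).1.1 \in placed cur),
    (values_at env 1).1.2 \notin placed cur, (values_at env 1).2 \notin placed cur
    & eval W pinput 4 env],
  pf (+) (odd (count (fun x => (values_at env 1).1.2 < x) (placed cur)) (+)
    odd (count (fun x => (values_at env 1).2 < x) (placed cur)) (+)
    eval W (plt 2 1) 4 env (+) eval W (plt 3 1) 4 env), pe, false)) //.
rewrite eval_pinput !eval_pzero !eval_plt // eval_peq // e0 val_at0.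
by rewrite /tpar !addbA.
Qed.

End Current.

(** The program state is only the second component of the specified fold; by [vstep_current] the
    first one is what [for_current] recovers by rescanning. *)
Lemma eval_ptrees : eval W ptrees 1 (fun=> 0) = trees_ok N I C.
Proof.
rewrite /ptrees eval_bind eval_for_triple /trees_ok -(tblocks_vals true).
set st0 := (true, false, false, true).
have key pre post : tblocks true W = pre ++ post ->
    foldl (fun s t => eval W (pstep s) 4 (shift3 1 t (fun=> 0)))
      (foldl (vstep N I) ([::], st0) (map (map3 (val_at W)) pre)).2 post =
    (foldl (vstep N I) (foldl (vstep N I) ([::], st0) (map (map3 (val_at W)) pre))
       (map (map3 (val_at W)) post)).2.
  elim: post pre => //= t post IH pre hpre.
  rewrite (eval_pstep _ _ hpre) // values_shift3 -(vstep_current N I st0).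
  by rewrite -surjective_pairing -foldl_rcons -map_rcons IH // cat_rcons.
rewrite (key [::]) //; by case: (foldl _ _ _) => ? [[[? ?] ?] ?].
Qed.

Lemma eval_peven : eval W peven 1 (fun=> 0) = even_ok N I C.
Proof.
rewrite /peven eval_for_triple /even_ok -{1}(tblocks_vals false) all_map.
rewrite -[RHS]andTb -foldl_and; apply: eq_in_foldl => t _ s.
rewrite eval_pand eval_ret eval_pneg eval_for_triple -(tblocks_vals true) [RHS]/= count_map.
rewrite -[odd _]addFb -foldl_xor; congr (_ && ~~ _).
apply: eq_in_foldl => t' _ b.
by rewrite eval_pxor eval_ret eval_pand eval_pneg eval_psep // eval_psame.
Qed.

Lemma eval_pinputs : eval W pinputs 1 (fun=> 0) = all (input_triple N) I.
Proof.
rewrite /pinputs eval_for_triple -(tblocks_vals false) all_map.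
rewrite -[RHS]andTb -foldl_and; apply: eq_in_foldl => t _ s.
rewrite !eval_pand eval_ret !eval_pneg !eval_plt // !eval_peq //.
by rewrite (shift3_1 1) (shift3_2 1) (shift3_3 1) shift3_low // val_at0.
Qed.

Lemma eval_pshape : eval W pshape 1 (fun=> 0) = shape_ok w.
Proof.
rewrite /pshape eval_bind eval_scan eval_ret /W /word_pair foldl_cat /=.
have stop r l : foldl shape_next (inr r) l = inr r.
  by elim: l.
have key p k v : foldl shape_next (inl (p, k)) (map Some v) =
    inl (~~ last (~~ p) v, inord ((k + count negb v) %% 3)).
  elim: v p k => [|b v IH] p k /=.
    rewrite negbK addn0 modn_small //; congr (inl (_, _)).
    by apply: val_inj; rewrite /= inordK.
  rewrite IH negbK; congr (inl (_, inord _)).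
  by case: b => //=; rewrite modnDml; congr (_ %% _); lia.
rewrite key /= stop /shape_ok add0n /=; congr (_ && (_ == _)).
by rewrite inordK // ltn_pmod.
Qed.

Theorem eval_verifier : eval W verifier 1 (fun=> 0) =
  ~~ (shape_ok w && all (input_triple N) I) || cert_ok N I C.
Proof.
rewrite /verifier eval_por eval_pneg !eval_pand.
by rewrite eval_pshape eval_pinputs eval_peven eval_ptrees.
Qed.

End Eval.
End Programs.

(** * Signs of words and cycles *)

Fixpoint invpar (l : seq nat) : bool :=
  if l is x :: l' then odd (count (fun y => y < x) l') (+) invpar l' else false.

Lemma invpar_rcons l x :
  invpar (rcons l x) = invpar l (+) odd (count (fun y => x < y) l).
Proof.
elim: l => //= y l ->; rewrite -cats1 count_cat /= addn0 !oddD oddb.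
by case: (x < y); do 2 case: (odd _); case: (invpar l).
Qed.

(** In a word of odd length, the first letter passes an even number of others on its way to the end.
    So the sign does not depend on where an odd cycle is cut. *)
Lemma invpar_rot n l : uniq l -> odd (size l) -> invpar (rot n l) = invpar l.
Proof.
have step l' : uniq l' -> odd (size l') -> invpar (rot 1 l') = invpar l'.
  case: l' => // x l' /= /andP[xl _] hs; rewrite rot1_cons invpar_rcons addbC.
  congr (_ (+) _).
  have E : size l' = count (fun y => y < x) l' + count (fun y => x < y) l'.
    rewrite -(count_predC (fun y => y < x)); congr (_ + _).
    apply: eq_in_count => y yl /=; rewrite -leqNgt leq_eqVlt.
    by case: eqP => // E; rewrite E yl in xl.
  by move: hs; rewrite E oddD; do 2 case: odd.
have [hn|hn] := leqP n (size l); last by rewrite rot_oversize // ltnW.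
elim: n hn => [|n IH] hn ul hs; first by rewrite rot0.
by rewrite rotS // step ?rot_uniq ?size_rot // IH // ltnW.
Qed.

Lemma invpar_homo (f : nat -> nat) l : {mono f : x y / x < y} ->
  invpar (map f l) = invpar l.
Proof.
by move=> hf; elim: l => //= x l ->; rewrite count_map; congr (odd _ (+) _);
  apply: eq_count => y /=; rewrite hf.
Qed.

(** The two letters in front see the rest only as a multiset. *)
Lemma invpar_perm l1 l2 y z : perm_eq l1 l2 -> invpar l1 = invpar l2 ->
  invpar [:: y, z & l1] = invpar [:: y, z & l2].
Proof. by move=> /seq.permP h /= ->; rewrite !h. Qed.

Lemma lift_perm_ex n (s : 'S_n.+1) : exists s', s = lift_perm ord0 (s ord0) s'.
Proof.
pose f (k : 'I_n) := odflt k (unlift (s ord0) (s (lift ord0 k))).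
have fK k : lift (s ord0) (f k) = s (lift ord0 k).
  rewrite /f; have := neq_lift ord0 k.
  by rewrite -(inj_eq (@perm_inj _ s)) => /unlift_some[] ? ? ->.
have fI : injective f.
  move=> k k' h; have := fK k; rewrite h fK => /perm_inj.
  by move/lift_inj.
exists (perm fI); apply/permP=> k; case: (unliftP ord0 k) => [k'|] ->.
  by rewrite lift_perm_lift permE fK.
by rewrite lift_perm_id.
Qed.

Lemma count_lt_iota k n : k <= n -> count (fun i => i < k) (iota 0 n) = k.
Proof.
move=> hk; rewrite -(subnKC hk) iotaD count_cat.
have -> : count (fun i => i < k) (iota 0 k) = k.
  rewrite -[RHS](size_iota 0) -count_predT; apply: eq_in_count => i.
  by rewrite mem_iota => /andP[].
rewrite (_ : count _ _ = 0) ?addn0 //; apply/eqP; rewrite -leqn0 leqNgt -has_count.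
by apply/hasPn => i; rewrite mem_iota add0n => /andP[h _]; rewrite -leqNgt.
Qed.

(** The first value [k] of the word is larger than exactly [k] later ones, which is the term that
    [odd_lift_perm] contributes; closing the gap at [k] preserves the order of the remaining
    values. *)
Lemma odd_perm_invpar N (s : 'S_N) :
  odd_perm s = invpar [seq val (s i) | i <- enum 'I_N].
Proof.
elim: N s => [|N IH] s.
  by rewrite (_ : s = 1%g) ?odd_perm1 ?(size0nil (size_enum_ord 0)) //;
    apply/permP => -[].
have [s' ->] := lift_perm_ex s; set k := s ord0.
rewrite odd_lift_perm /= enum_ordSl /= lift_perm_id IH; congr (_ (+) _).
  rewrite -map_comp; set l := map _ _.
  have -> : l = [seq bump k (s' i) | i <- enum 'I_N].
    by apply: eq_map => i; rewrite /= lift_perm_lift.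
  rewrite count_map (_ : count _ _ = count (fun i : 'I_N => i < k) (enum 'I_N)).
    rewrite -(count_map val (fun i => i < k)) val_enum_ord.
    by rewrite count_lt_iota // -ltnS.
  have -> : count (preim (fun i => bump k (s' i)) (fun y => y < k)) (enum 'I_N) =
      count (fun i : 'I_N => i < k) (map s' (enum 'I_N)).
    by rewrite [RHS]count_map; apply: eq_count => i /=; rewrite /bump; case: leqP; lia.
  suff /seq.permP : perm_eq (map s' (enum 'I_N)) (enum 'I_N) by apply.
  apply: uniq_perm; rewrite ?(map_inj_uniq (@perm_inj _ s')) ?enum_uniq //.
  move=> i; rewrite mem_enum; apply/mapP; exists (s'^-1 i)%g; rewrite ?mem_enum //.
  by rewrite permKV.
rewrite -map_comp -(@invpar_homo (bump k)); last first.
  by move=> x y; rewrite /bump; case: leqP; case: leqP; lia.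
rewrite -map_comp; congr invpar; apply: eq_map => i.
by rewrite /= lift_perm_lift.
Qed.

(** * Cycle notation up to rotation *)

Section Cycles.

Variable V : finType.
Implicit Types (p q : {perm V}) (c : seq V).

Lemma notationP c p : reflect (uniq c /\ p =1 next c) (is_cycle_notation c p).
Proof.
apply: (iffP andP) => -[h1 h2]; split=> //.
  by move=> x; apply/eqP; move/forallP: h2.
by apply/forallP => x; apply/eqP.
Qed.

Lemma notation_rot n c p : is_cycle_notation (rot n c) p = is_cycle_notation c p.
Proof.
apply/notationP/notationP; rewrite rot_uniq => -[h1 h2]; split=> // x.
  by rewrite h2 next_rot.
by rewrite h2 next_rot.
Qed.

Lemma notation_fcycle c p : is_cycle_notation c p -> fcycle p c.
Proof.
move=> /notationP[h1 h2]; rewrite (eq_fcycle h2); exact: cycle_next.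
Qed.

(** Rotated to the same first letter, both words are the trajectory of [p] from it. Equality of the
    letters has to be assumed, as the identity is written by the empty word and by every single
    letter. *)
Lemma notation_unique c1 c2 p : is_cycle_notation c1 p -> is_cycle_notation c2 p ->
  perm_eq c1 c2 -> exists n, c2 = rot n c1.
Proof.
case: c1 => [|x l] h1 h2 h12.
  by exists 0; move/perm_size/esym/size0nil: h12.
have xc : x \in c2 by rewrite -(perm_mem h12) mem_head.
have [i l' hr] := rot_to xc.
have h3 : is_cycle_notation (x :: l') p by rewrite -hr notation_rot.
have hs : size l' = size l.
  by have := congr1 size hr; rewrite size_rot -(perm_size h12) => -[].
have trj m : is_cycle_notation (x :: m) p -> m = traject p (p x) (size m).
  move=> /notation_fcycle /=; rewrite rcons_path => /andP[/fpathE ? _] //.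
have e : x :: l = rot i c2 by rewrite hr (trj _ h1) (trj _ h3) hs.
exists (size c2 - i); rewrite e.
have [hi|hi] := leqP i (size c2).
  by rewrite -{1}(size_rot i c2) -/(rotr i _) rotK.
by rewrite (rot_oversize (ltnW hi)) (eqP (ltnW hi : _ - _ == 0)) rot0.
Qed.

End Cycles.

(** * Growth sequences *)

Section Growth.

Variables (V : eqType) (r : V).
Implicit Types (t : V * V * V) (b : seq (V * V * V)).

Definition tlist t : seq V := [:: t.1.1; t.1.2; t.2].

(* The most recently attached triple comes first. *)
Fixpoint vertices b : seq V :=
  if b is t :: b' then [:: t.1.2, t.2 & vertices b'] else [:: r].

Fixpoint grown b : bool :=
  if b is t :: b' then
    [&& t.1.1 \in vertices b', t.1.2 \notin vertices b', t.2 \notin vertices b',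
        t.1.2 != t.2 & grown b']
  else true.

Lemma root_vertices b : r \in vertices b.
Proof. by elim: b => [|t b IH]; rewrite /= ?mem_head // !inE IH !orbT. Qed.

Lemma vertices_uniq b : grown b -> uniq (vertices b).
Proof.
by elim: b => //= t b IH /and5P[_ h1 h2 h3 /IH->]; rewrite inE negb_or h3 h1 h2.
Qed.

Lemma size_vertices b : size (vertices b) = (size b).*2.+1.
Proof. by elim: b => //= t b ->. Qed.

Lemma mem_vertices b t x : grown b -> t \in b -> x \in tlist t -> x \in vertices b.
Proof.
elim: b => //= t' b IH /and5P[h1 _ _ _ hb]; rewrite inE => /predU1P[->|tb] xt.
  by move: xt; rewrite !inE => /or3P[] /eqP->; rewrite ?eqxx ?h1 ?orbT.
by rewrite !inE IH ?orbT.
Qed.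

Lemma grown_uniq3 b t : grown b -> t \in b -> uniq (tlist t).
Proof.
elim: b => //= t' b IH /and5P[h1 h2 h3 h4 hb]; rewrite inE => /predU1P[->|/IH]; last exact.
rewrite /= !inE negb_or h4 !andbT; apply/andP; split; apply/eqP => E.
  by rewrite -E h1 in h2.
by rewrite -E h1 in h3.
Qed.

End Growth.

(** * Products of 3-cycles along a growth sequence *)

Section Products.

Variable V : finType.
Implicit Types (p q : {perm V}) (c : seq V) (t : V * V * V) (b : seq (V * V * V)).

Definition tset t : {set V} := [set t.1.1; t.1.2; t.2].

Definition tree_set b : {set {set V}} := [set s in map tset b].

Lemma in_tset x t : (x \in tset t) = (x \in tlist t).
Proof. by rewrite !inE orbA. Qed.

Lemma notation_out c p x : is_cycle_notation c p -> x \notin c -> p x = x.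
Proof. by move=> /notationP[_ ->] /negPf h; rewrite next_nth h. Qed.

Lemma notation_on c p : is_cycle_notation c p -> perm_on [set x in c] p.
Proof.
move=> h; apply/subsetP => x; rewrite !inE; apply: contraNT => xc.
by rewrite (notation_out h).
Qed.

Lemma notation_conj c p q : is_cycle_notation c p -> is_cycle_notation (map q c) (p ^ q)%g.
Proof.
move=> /notationP[h1 h2]; apply/notationP; split.
  by rewrite (map_inj_uniq perm_inj).
move=> x; rewrite -(permKV q x) permJ h2 next_map //; exact: perm_inj.
Qed.

Lemma notation_of_fcycle c p : uniq c -> fcycle p c ->
  (forall x, x \notin c -> p x = x) -> is_cycle_notation c p.
Proof.
move=> uc hc ho; apply/notationP; split=> // x.
have [xc|xc] := boolP (x \in c); first by have /= /eqP := next_cycle hc xc.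
by rewrite ho // next_nth (negbTE xc).
Qed.

Lemma fpath_fixed p q x s : fpath p x s -> (forall v, v \in s -> q v = v) ->
  fpath (p * q)%g x s.
Proof.
elim: s x => //= v s IH x /andP[/eqP <- hs] hv.
rewrite permM hv ?mem_head // eqxx /= IH // => u us.
by apply: hv; rewrite inE us orbT.
Qed.

(** In [p * q] the factor [p] acts first: the predecessor of [a] goes to [a] and then on to [y], so
    [y z] enters just in front of [a]. The pair is written at the head of the word to match
    [vertices]. *)
Lemma notation_insert a y z c p q :
    is_cycle_notation (a :: c) p -> is_cycle_notation [:: a; y; z] q ->
    y \notin a :: c -> z \notin a :: c ->
  is_cycle_notation [:: y, z, a & c] (p * q)%g.
Proof.
move=> hp hq yc zc; have [up _] := notationP _ _ hp; have [uq eq] := notationP _ _ hq.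
have py := notation_out hp yc; have pz := notation_out hp zc.
have /= /and4P[/eqP qa /eqP qy /eqP qz _] := notation_fcycle hq.
apply: notation_of_fcycle.
- move: uq; rewrite /= !inE !negb_or in yc zc *; rewrite andbT => /andP[_ ->].
  by case/andP: yc => -> ->; case/andP: zc => -> ->; move: up => /=.
- rewrite /= !permM py pz qy qz !eqxx /=.
  have /= := notation_fcycle hp; rewrite !rcons_path => /andP[h1 /eqP h2].
  rewrite fpath_fixed // => [|v vc] /=; first by rewrite permM h2 qa eqxx.
  have vac : v \in a :: c by rewrite inE vc orbT.
  apply: (notation_out hq); rewrite !inE !negb_or; apply/and3P; split.
  + by apply/eqP => E; move: up; rewrite /= -E vc.
  + by apply/eqP => E; rewrite -E vac in yc.
  + by apply/eqP => E; rewrite -E vac in zc.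
move=> x; rewrite !inE !negb_or => /and4P[xy xz xa xc].
rewrite permM (notation_out hp) ?inE ?negb_or ?xa //.
by rewrite (notation_out hq) // !inE !negb_or xa xy.
Qed.

Lemma prod_on (A : {set V}) (I : Type) (L : seq I) (f : I -> {perm V}) (P : pred I) :
  all P L -> (forall i, P i -> perm_on A (f i)) -> perm_on A (\prod_(i <- L) f i)%g.
Proof.
move=> + h; elim: L => [|i L IH] /=; first by rewrite big_nil perm_on1.
by case/andP=> /h hi /IH hL; rewrite big_cons perm_onM.
Qed.

End Products.

Definition vals N (c : seq 'I_N) : seq nat := map val c.

Lemma notation_vals N (c1 c2 : seq 'I_N) p :
    is_cycle_notation c1 p -> is_cycle_notation c2 p -> perm_eq c1 c2 -> odd (size c1) ->
  invpar (vals c1) = invpar (vals c2).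
Proof.
move=> h1 h2 h12 hs; have [n ->] := notation_unique h1 h2 h12.
rewrite /vals map_rot invpar_rot ?size_map //.
by rewrite map_inj_uniq ?(proj1 (notationP _ _ h1)) //; apply: val_inj.
Qed.

(* Peeling off the last attached triple [t] from [A * s * B] gives
   [(A * B) * s ^ B], where [B] fixes both new vertices of [t]. *)
Lemma notation_prod N (r : 'I_N) b (f : 'I_N * 'I_N * 'I_N -> {perm 'I_N}) L :
    grown r b -> (forall t, t \in b -> is_cycle_notation (tlist t) (f t)) ->
    perm_eq L b ->
  exists c, [/\ is_cycle_notation c (\prod_(t <- L) f t)%g, perm_eq c (vertices r b)
    & invpar (vals c) = invpar (vals (vertices r b))].
Proof.
elim: b L => [|t b IH] L /=.
  move=> _ _ /perm_size/size0nil->; exists [:: r]; split=> //.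
  by rewrite big_nil; apply: notation_of_fcycle => //= [|x _]; rewrite perm1 ?eqxx.
case/and5P=> ha hy hz hyz hb hf hL.
have tL : t \in L by rewrite (perm_mem hL) mem_head.
case/splitPr: tL hL => L1 L2 hL.
have hL12 : perm_eq (L1 ++ L2) b.
  by rewrite -(perm_cons t) -(permPr hL) -(cat1s t L2) perm_sym perm_catCA.
have [c [hc1 hc2 hc3]] := IH _ hb (fun t' ht' => hf _ (mem_behead (s := t :: b) ht')) hL12.
set A := (\prod_(t <- L1) f t)%g; set B := (\prod_(t <- L2) f t)%g.
have -> : (\prod_(t <- L1 ++ t :: L2) f t = A * B * f t ^ B)%g.
  by rewrite big_cat big_cons /= conjgE !mulgA mulgK.
have hAB : (\prod_(t <- L1 ++ L2) f t = A * B)%g by rewrite big_cat.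
have onB : perm_on [set x in vertices r b] B.
  apply: (@prod_on _ _ _ L2 f (mem b)).
    by apply/allP => t' ht'; rewrite /= -(perm_mem hL12) mem_cat ht' orbT.
  move=> t' /= ht'; apply: subset_trans (notation_on (hf t' _)) _.
    by rewrite inE ht' orbT.
  by apply/subsetP => x; rewrite !in_set; apply: mem_vertices.
have hB := notation_conj B (hf t (mem_head _ _)).
have By : B t.1.2 = t.1.2 by rewrite (out_perm onB) // inE.
have Bz : B t.2 = t.2 by rewrite (out_perm onB) // inE.
have Ba : B t.1.1 \in c.
  by have := perm_closed t.1.1 onB; rewrite !in_set (perm_mem hc2) => ->.
rewrite /= By Bz in hB.
(* The conjugated 3-cycle is attached at [B t.1.1], so the cycle of [A * B] is cut there; the cut
   does not change the parity because the length is odd. *)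
have [i c' hrot] := rot_to Ba.
have hac : perm_eq (B t.1.1 :: c') (vertices r b).
  by rewrite -hrot; apply: perm_trans hc2; rewrite perm_rot.
exists [:: t.1.2, t.2, B t.1.1 & c']; split.
- apply: notation_insert => //; rewrite ?(perm_mem hac) //.
  by rewrite -hrot notation_rot -hAB.
- by rewrite !perm_cons.
apply: (@invpar_perm (vals (B t.1.1 :: c')) (vals (vertices r b))).
  exact: perm_map.
rewrite -[LHS]/(invpar (vals (_ :: c'))) -hrot /vals map_rot invpar_rot //.
  by rewrite (map_inj_uniq val_inj) (perm_uniq hc2) vertices_uniq.
by rewrite size_map (perm_size hc2) size_vertices /= odd_double.
Qed.

(** * The sign of a grown tree as a function of the orientation *)

Section Sign.

Variable N : nat.
Implicit Types (omega : {set 'I_N} -> {perm 'I_N}) (t : 'I_N * 'I_N * 'I_N)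
  (b : seq ('I_N * 'I_N * 'I_N)) (c : seq 'I_N).

Lemma sgn_notation omega (T : {set {set 'I_N}}) c :
    is_cycle_notation c (\prod_(t in T) omega t)%g -> perm_eq c (enum 'I_N) ->
    odd N -> sgn omega T = ((-1) ^+ invpar (vals c))%R.
Proof.
move=> hc hcN oddN; rewrite /sgn; case: pickP => [s hs|hno].
  rewrite odd_perm_invpar; congr (_ ^+ nat_of_bool _)%R.
  rewrite (map_comp val s); apply: notation_vals hs hc _ _.
    rewrite perm_sym (perm_trans hcN) // perm_sym; apply: uniq_perm.
    - by rewrite (map_inj_uniq perm_inj) enum_uniq.
    - exact: enum_uniq.
    move=> i; rewrite mem_enum; apply/mapP; exists (s^-1 i)%g; rewrite ?mem_enum //.
    by rewrite permKV.
  by rewrite size_map size_enum_ord.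
(* It remains to exclude the default value 0: the word [c] itself defines a permutation that [pick]
   could have returned. *)
have N0 : 0 < N by case: (N) oddN.
pose r := Ordinal N0.
have sc : size c = N by rewrite (perm_size hcN) size_enum_ord.
have fI : injective (fun i : 'I_N => nth r c i).
  move=> i j /eqP; rewrite nth_uniq ?sc ?ltn_ord //; first by move/eqP/val_inj.
  by rewrite (perm_uniq hcN) enum_uniq.
have := hno (perm fI); suff -> : [seq perm fI i | i <- enum 'I_N] = c by rewrite hc.
rewrite (eq_map (permE _)) (map_comp (nth r c) val) val_enum_ord.
by have := mkseq_nth r c; rewrite sc.
Qed.

(* Rotating a word of length 3 is an even permutation, so the bit does not depend
   on how the 3-cycle is written. *)
Definition obit omega (s : {set 'I_N}) : bool :=
  [exists t : 'I_N * 'I_N * 'I_N, [&& s == tset t, is_cycle_notation (tlist t) (omega s)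
    & invpar (vals (tlist t))]].

Lemma tset_perm t t' : uniq (tlist t) -> uniq (tlist t') -> tset t = tset t' ->
  perm_eq (tlist t) (tlist t').
Proof.
move=> ut ut' /setP E; apply: uniq_perm => // x.
by rewrite -!in_tset E.
Qed.

Lemma obitE omega t : is_cycle_notation (tlist t) (omega (tset t)) ->
  obit omega (tset t) = invpar (vals (tlist t)).
Proof.
move=> ht; have [ut _] := notationP _ _ ht.
apply/existsP/idP => [[t' /and3P[/eqP E h1 h2]]|h]; last by exists t; rewrite eqxx ht.
have [ut' _] := notationP _ _ h1.
rewrite -(notation_vals h1 ht) //; apply: tset_perm => //.
Qed.

Definition flip3 t := (t.1.1, t.2, t.1.2).

Lemma tset_flip t : tset (flip3 t) = tset t.
Proof. by apply/setP => x; rewrite !inE -!orbA; congr (_ || _); rewrite orbC. Qed.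

Lemma notation_flip (p : {perm 'I_N}) t i j k : uniq (tlist t) ->
    tset t = [set i; j; k] -> is_cycle_notation [:: i; j; k] p ->
  is_cycle_notation (tlist t) p || is_cycle_notation (tlist (flip3 t)) p.
Proof.
move=> ut E hp; have [up _] := notationP _ _ hp.
have hperm : perm_eq (tlist t) [:: i; j; k] by apply: (@tset_perm t (i, j, k)).
have ai : t.1.1 \in [:: i; j; k] by rewrite -(perm_mem hperm) mem_head.
have [n l hr] := rot_to ai; rewrite -(notation_rot n) hr in hp.
have : perm_eq [:: t.1.2; t.2] l.
  rewrite -(perm_cons t.1.1) -hr; apply: perm_trans hperm _.
  by rewrite perm_sym perm_rot.
move: ut; rewrite /= !inE => /and3P[_ yz _]; case: l hp {hr} => [|u [|v [|? ?]]] hp hl;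
  try by move/perm_size: hl.
have [hu hv] : u \in [:: t.1.2; t.2] /\ v \in [:: t.1.2; t.2].
  by rewrite !(perm_mem hl) !inE !eqxx orbT.
have uv : u != v by move: (perm_uniq hl); rewrite /= !inE !andbT yz => <-.
move: hu hv uv; rewrite !inE => /orP[] /eqP Eu /orP[] /eqP Ev; subst u v;
  by rewrite ?eqxx //= /tlist /= hp ?orbT.
Qed.

(** Exchanging the two new vertices of a triple keeps the growth sequence valid. In this way every
    factor of the product becomes the 3-cycle spelled by its tuple, as [notation_prod] requires. *)
Definition orient omega t :=
  if is_cycle_notation (tlist t) (omega (tset t)) then t else flip3 t.

Lemma tset_orient omega t : tset (orient omega t) = tset t.
Proof. by rewrite /orient; case: ifP; rewrite ?tset_flip. Qed.

Variable r : 'I_N.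

Lemma vertices_orient omega b :
  perm_eq (vertices r (map (orient omega) b)) (vertices r b).
Proof.
elim: b => //= t b IH; rewrite /orient; case: ifP => _ /=; first by rewrite !perm_cons.
by rewrite (perm_catCA [:: t.2] [:: t.1.2]) /= !perm_cons.
Qed.

Lemma grown_orient omega b : grown r b -> grown r (map (orient omega) b).
Proof.
elim: b => //= t b IH /and5P[h1 h2 h3 h4 /IH ->].
rewrite !(perm_mem (vertices_orient omega b)) andbT /orient.
by case: ifP => _ /=; rewrite ?h1 ?h2 ?h3 ?h4 // eq_sym.
Qed.

Lemma invpar_orient omega b : grown r b ->
  invpar (vals (vertices r (map (orient omega) b))) = invpar (vals (vertices r b)) (+)
  \big[addb/false]_(t <- b) ~~ is_cycle_notation (tlist t) (omega (tset t)).
Proof.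
elim: b => [|t b IH] /=; first by rewrite big_nil.
case/and5P=> _ _ _ yz /IH {}IH; rewrite big_cons.
have /seq.permP E := perm_map val (vertices_orient omega b).
rewrite -/(vals _) in E *; rewrite /orient; case: ifP => _ /=.
  by rewrite IH !E -!addbA.
rewrite IH !E !oddD !oddb; have -> : (t.1.2 < t.2) = ~~ (t.2 < t.1.2).
  by case: ltngtP yz => // /val_inj->; rewrite eqxx.
rewrite -/(vals (vertices r b)); case: (t.2 < t.1.2); case: (odd _); case: (odd _);
  by case: (invpar _); case: (\big[addb/false]_(_ <- _) _).
Qed.

Lemma tset_uniq b : grown r b -> uniq (map (@tset _) b).
Proof.
elim: b => //= t b IH /and5P[h1 h2 h3 h4 hb]; rewrite IH // andbT.
apply/mapP => -[t' tb /setP/(_ t.2)]; rewrite !in_tset /tlist !inE eqxx !orbT => /esym h.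
by rewrite (mem_vertices hb tb) ?inE in h3.
Qed.

Definition oriented omega (s : {set 'I_N}) : Prop :=
  exists i j k, s = [set i; j; k] /\ is_cycle_notation [:: i; j; k] (omega s).

(** The summand of [t] is 1 exactly if [omega] runs through the triple against the order of the
    tuple. Splitting it into two bits isolates [obit], which depends on the set alone, so the
    exponent is an affine function of the bits of the orientation. *)
Lemma sgn_grown omega b : grown r b -> perm_eq (vertices r b) (enum 'I_N) ->
    {in b, forall t, oriented omega (tset t)} ->
  sgn omega (tree_set b) = ((-1) ^+ (invpar (vals (vertices r b)) (+)
    \big[addb/false]_(t <- b) (invpar (vals (tlist t)) (+) obit omega (tset t))))%R.
Proof.
move=> hb hN ho.
have hnot t : t \in b -> is_cycle_notation (tlist t) (omega (tset t)) ||
    is_cycle_notation (tlist (flip3 t)) (omega (tset t)).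
  move=> tb; have [i [j [k [E h]]]] := ho t tb.
  by apply: notation_flip E h; apply: grown_uniq3 hb tb.
have [e he [ue eT] _] := big_enumP (fun s => s \in tree_set b).
have hL : perm_eq e (map (@tset _) (map (orient omega) b)).
  apply: uniq_perm => //.
    by apply: tset_uniq; apply: grown_orient.
  move=> s; rewrite eT inE -map_comp; congr (s \in _).
  by apply: eq_map => t; rewrite /= tset_orient.
set b' := map (orient omega) b in hL.
(* The product over a set of triples is taken in an unspecified order; this order is lifted to a
   rearrangement [L] of the tuples. *)
have [L hL1 hL2] : exists2 L, perm_eq L b' & e = map (@tset _) L.
  have [Is hIs E] := perm_iotaP set0 hL; rewrite size_map in hIs.
  exists (map (nth (r, r, r) b') Is); first by apply/(perm_iotaP (r, r, r)); exists Is.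
  rewrite E -[RHS]map_comp; apply/eq_in_map => i; rewrite (perm_mem hIs) mem_iota => /= hi.
  by rewrite (nth_map (r, r, r)).
have hb' : grown r b' by apply: grown_orient.
have hf t : t \in b' -> is_cycle_notation (tlist t) (omega (tset t)).
  case/mapP=> t' /hnot + ->; rewrite tset_orient /orient.
  by case: ifP.
have [c [hc1 hc2 hc3]] := notation_prod hb' hf hL1.
have hcN : perm_eq c (enum 'I_N).
  by apply: perm_trans hc2 (perm_trans (vertices_orient _ _) hN).
have oddN : odd N.
  by rewrite -(size_enum_ord N) -(perm_size hN) size_vertices /= odd_double.
have hc : is_cycle_notation c (\prod_(s in tree_set b) omega s)%g.
  by rewrite -he hL2 big_map.
rewrite (sgn_notation hc hcN oddN).
rewrite hc3 invpar_orient //; congr (_ ^+ nat_of_bool (_ (+) _))%R.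
apply: eq_big_seq => t tb; have := hnot t tb.
have [h _|_ /= h] := boolP (is_cycle_notation _ _); first by rewrite obitE // addbb.
rewrite -(tset_flip t) obitE ?tset_flip //.
have /= := grown_uniq3 hb tb; rewrite !inE => /and3P[_ yz _].
have E : (t.1.2 < t.2) = ~~ (t.2 < t.1.2).
  by case: ltngtP yz => // /val_inj->; rewrite eqxx.
rewrite /= !addn0 !oddD !oddb E.
by case: (t.2 < t.1.2); case: (t.1.2 < t.1.1); case: (t.2 < t.1.1).
Qed.

End Sign.

(** * Spanning trees *)

Section SpanningTrees.

Variables (N : nat) (r : 'I_N).
Notation V := 'I_N.
Implicit Types (T D : {set {set V}}) (s : {set V}) (b : seq (V * V * V)) (x y : V)
  (p : seq ({set V} * V)).

Lemma tree_set_cons t b : tree_set (t :: b) = tset t |: tree_set b.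
Proof. by apply/setP => s; rewrite !inE. Qed.

Fixpoint steps T x p : bool :=
  if p is sv :: p' then [&& sv.1 \in T, x \in sv.1, sv.2 \in sv.1 & steps T sv.2 p']
  else true.

Definition simple_path T x p : bool :=
  [&& steps T x p, uniq (x :: unzip2 p) & uniq (unzip1 p)].

Definition endpoint x p := last x (unzip2 p).

Lemma steps_nth T x p i : steps T x p -> i < size p ->
  [/\ nth set0 (unzip1 p) i \in T, nth x (x :: unzip2 p) i \in nth set0 (unzip1 p) i
    & nth x (unzip2 p) i \in nth set0 (unzip1 p) i].
Proof.
have key d q y : steps T y q -> i < size q ->
  [/\ nth set0 (unzip1 q) i \in T, nth d (y :: unzip2 q) i \in nth set0 (unzip1 q) i
    & nth d (unzip2 q) i \in nth set0 (unzip1 q) i].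
  elim: q y i => //= -[s v] q IH y [|i] /=; first by case/and4P.
  by case/and4P => _ _ _ h1 h2; apply: IH.
exact: key.
Qed.

Lemma steps_sub T T' x p : T \subset T' -> steps T x p -> steps T' x p.
Proof.
move=> /subsetP hT; elim: p x => //= sv p IH x /and4P[/hT-> -> -> /IH->] //.
Qed.

Lemma steps_unzip1 T x p s : steps T x p -> s \in unzip1 p -> s \in T.
Proof.
elim: p x => //= sv p IH x /and4P[h _ _ /IH {}IH].
by rewrite inE => /predU1P[->|/IH].
Qed.

Lemma steps_rcons T x p sv : steps T x (rcons p sv) =
  [&& steps T x p, sv.1 \in T, endpoint x p \in sv.1 & sv.2 \in sv.1].
Proof.
rewrite /endpoint; elim: p x => [|u p IH] x /=; first by rewrite andbT.
by rewrite IH -!andbA.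
Qed.

Lemma joined_simple T x p : simple_path T x p -> joined T x (endpoint x p).
Proof.
case/and3P=> hp u2 u1; have s1 : size (unzip1 p) = size p by rewrite size_map.
have s2 : size (x :: unzip2 p) = (size p).+1 by rewrite /= size_map.
exists (size p), (fun i : 'I_(size p).+1 => nth x (x :: unzip2 p) i),
  (fun i : 'I_(size p) => nth set0 (unzip1 p) i); split=> //.
- by move=> i j /eqP; rewrite nth_uniq ?s2 ?ltn_ord // => /eqP/val_inj.
- by move=> i j /eqP; rewrite nth_uniq ?s1 ?ltn_ord // => /eqP/val_inj.
- by rewrite /endpoint (last_nth x) size_map.
- by move=> i; have [] := steps_nth hp (ltn_ord i).
Qed.

(** The triple [s] closes the path; a nonempty path makes the length of the cycle at least 2. *)
Lemma cycle_simple T T' x p s : simple_path T x p -> T \subset T' ->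
    s \in T' -> s \notin T -> x \in s -> endpoint x p \in s -> p != [::] ->
  has_cycle T'.
Proof.
case/and3P=> hp u2 u1 hT sT' sT xs ys p0.
have s1 : size (rcons (unzip1 p) s) = (size p).+1 by rewrite size_rcons size_map.
have s2 : size (x :: unzip2 p) = (size p).+1 by rewrite /= size_map.
have ur : uniq (rcons (unzip1 p) s).
  by rewrite rcons_uniq u1 andbT; apply: contra sT; apply: steps_unzip1 hp.
exists (size p).+1, (fun i : 'I_(size p).+1 => nth x (x :: unzip2 p) i),
  (fun i : 'I_(size p).+1 => nth set0 (rcons (unzip1 p) s) i); split.
- by rewrite ltnS lt0n size_eq0.
- by move=> i j /eqP; rewrite nth_uniq ?s2 ?ltn_ord // => /eqP/val_inj.
- by move=> i j /eqP; rewrite nth_uniq ?s1 ?ltn_ord // => /eqP/val_inj.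
move=> i; rewrite nth_rcons size_map /=; have := ltn_ord i; rewrite ltnS leq_eqVlt.
case/predU1P=> [->|ip].
  by rewrite ltnn eqxx modnn /=; split=> //; move: ys; rewrite /endpoint (last_nth x) size_map.
rewrite ip modn_small ?ltnS //=; have [h1 h2 h3] := steps_nth hp ip.
by split=> //; apply: (subsetP hT).
Qed.

Lemma tset_vertices b t : grown r b -> t \in b -> tset t \subset vertices r b.
Proof.
by move=> hb tb; apply/subsetP => x; rewrite in_tset; apply: mem_vertices.
Qed.

Lemma tree_set_vertices b s x : grown r b -> s \in tree_set b -> x \in s ->
  x \in vertices r b.
Proof. by move=> hb; rewrite inE => /mapP[t tb ->]; apply/subsetP/tset_vertices. Qed.

Lemma tset_new b t : grown r (t :: b) -> tset t \notin tree_set b.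
Proof. by move=> /tset_uniq /=; rewrite inE => /andP[]. Qed.

(** The last clause keeps the path away from vertices attached later, so that it stays simple when
    such a vertex is added at one of its ends. *)
Lemma grown_path b x y : grown r b -> x \in vertices r b -> y \in vertices r b ->
  exists p, [/\ simple_path (tree_set b) x p, endpoint x p = y
               & {subset unzip2 p <= vertices r b}].
Proof.
elim: b x y => [|t b IH] x y /=.
  by rewrite !inE => _ /eqP-> /eqP->; exists [::].
move=> /[dup] htb /and5P[ha hy hz hyz hb].
have hsub : tree_set b \subset tree_set (t :: b) by rewrite tree_set_cons subsetUr.
have tT : tset t \in tree_set (t :: b) by rewrite tree_set_cons setU11.
have ht := tset_new htb.
have snew p u : steps (tree_set b) u p -> tset t \notin unzip1 p.
  by move=> hp; apply: contra ht; apply: steps_unzip1 hp.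
pose new u := (u == t.1.2) || (u == t.2).
have mem_new u : u \in [:: t.1.2, t.2 & vertices r b] = new u || (u \in vertices r b).
  by rewrite !inE orbA.
have new_in u : new u -> u \in tset t.
  by rewrite in_tset !inE => /orP[] ->; rewrite !orbT.
have new_out u : new u -> u \notin vertices r b by move=> /orP[] /eqP->.
have at_ : t.1.1 \in tset t by rewrite in_tset mem_head.
rewrite !mem_new => /orP[nx|ox] /orP[ny|oy].
- have [<-|xy] := eqVneq x y; first by exists [::].
  exists [:: (tset t, y)]; split=> //.
    by rewrite /simple_path /= tT !new_in //= mem_seq1 xy.
  by move=> u; rewrite inE => /eqP->; rewrite mem_new ny.
- have [p [/and3P[h1 h2 h3] h4 h5]] := IH _ _ hb ha oy.
  exists ((tset t, t.1.1) :: p); split=> //.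
    rewrite /simple_path /= tT new_in // at_ (steps_sub hsub h1) (snew _ _ h1) h3 !andbT /=.
    move: h2 => /= ->; rewrite andbT inE negb_or.
    have xo := new_out x nx; apply/andP; split.
      by apply: contra xo => /eqP->.
    by apply: contra xo; apply: h5.
  move=> u; rewrite inE mem_new => /predU1P[->|/h5->]; rewrite ?orbT //.
  by rewrite ha orbT.
- have [p [/and3P[h1 h2 h3] h4 h5]] := IH _ _ hb ox ha.
  exists (rcons p (tset t, y)); split=> //.
  + apply/and3P; split.
    * by rewrite steps_rcons (steps_sub hsub h1) tT /= h4 at_ new_in.
    * rewrite /unzip2 map_rcons -rcons_cons rcons_uniq [uniq _]h2 andbT inE negb_or /=.
      have yo := new_out y ny; apply/andP; split.
        by apply: contra yo => /eqP->.
      by apply: contra yo; apply: h5.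
    * by rewrite /unzip1 map_rcons rcons_uniq [uniq _]h3 andbT; apply: snew h1.
  + by rewrite /endpoint /unzip2 map_rcons last_rcons.
  move=> u; rewrite /unzip2 map_rcons mem_rcons inE mem_new => /predU1P[->|/h5->].
    by rewrite ny.
  by rewrite orbT.
- have [p [/and3P[h1 h2 h3] h4 h5]] := IH _ _ hb ox oy.
  exists p; split=> //; first by rewrite /simple_path (steps_sub hsub h1) h2.
  by move=> u /h5; rewrite mem_new orbC => ->.
Qed.

(** A cycle through the last attached triple has two distinct vertices in it, one of which must be
    new. This vertex also lies in a neighbouring, different triple of the cycle, yet a new vertex
    lies in no other triple. *)
Lemma grown_acyclic b : grown r b -> ~ has_cycle (tree_set b).
Proof.
elim: b => [|t b IH].
  move=> _ [l [a [s [l2 _ _ /(_ (Ordinal (ltnW l2)))[]]]]].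
  by rewrite inE.
move=> /[dup] htb /and5P[ha hy hz hyz hb] [l [a [s [l2 aI sI hc]]]].
have only u v : u \in s v -> u \notin vertices r b -> s v = tset t.
  move=> us ub; have [+ _ _] := hc v; rewrite tree_set_cons inE => /orP[].
    by rewrite inE => /eqP.
  by move=> h; rewrite (tree_set_vertices hb h us) in ub.
have [/existsP[i /eqP si]|/existsPn hs] := boolP [exists i, s i == tset t].
  have [_ ai ai'] := hc i.
  have ii : ordS i != i.
    apply/eqP => /(congr1 val) /= E; have := ltn_ord i; rewrite leq_eqVlt => /predU1P[E'|h].
      by move: E; rewrite E' modnn => E0; move: E' l2; rewrite -E0 => <-.
    by move: E; rewrite modn_small // => /esym/n_Sn.
  have new u : u \in tset t -> u \in vertices r b -> u = t.1.1.
    rewrite in_tset !inE => /or3P[] /eqP-> //; first by rewrite (negbTE hy).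
    by rewrite (negbTE hz).
  have [o1|o1] := boolP (a (ordS i) \in vertices r b); last first.
    have [_ h _] := hc (ordS i).
    by move/eqP: ii; apply; apply: sI; rewrite (only _ _ h o1).
  have [o2|o2] := boolP (a i \in vertices r b).
    by move/eqP: ii; apply; apply: aI; rewrite si in ai ai'; rewrite (new _ ai) // (new _ ai').
  have [_ _ h] := hc (ord_pred i); rewrite ord_predK in h.
  have E : ord_pred i = i by apply: sI; rewrite (only _ _ h o2).
  by move/eqP: ii; apply; rewrite -{1}E ord_predK.
apply: (IH hb); exists l, a, s; split=> // i; have [h1 h2 h3] := hc i; split=> //.
by move: h1; rewrite tree_set_cons !inE (negbTE (hs i)).
Qed.

Lemma grown_cover b x : grown r b -> b != [::] -> x \in vertices r b ->
  x \in cover (tree_set b).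
Proof.
have key t b' u : u \in tset t -> u \in cover (tree_set (t :: b')).
  by move=> h; apply/bigcupP; exists (tset t) => //; rewrite tree_set_cons setU11.
have mono t b' : cover (tree_set b') \subset cover (tree_set (t :: b')).
  by rewrite tree_set_cons /cover bigcup_setU subsetUr.
elim: b => // t b IH /= /and5P[ha hy hz hyz hb] _; rewrite !inE => /or3P[/eqP->|/eqP->|hx].
- by apply: key; rewrite in_tset !inE eqxx orbT.
- by apply: key; rewrite in_tset !inE eqxx !orbT.
have [b0|b0] := eqVneq b [::]; last by apply: (subsetP (mono t b)); apply: IH.
by apply: key; rewrite in_tset; move: ha hx; rewrite b0 !inE => /eqP-> /eqP->; rewrite eqxx.
Qed.

Lemma grown_spanning D b : grown r b -> b != [::] -> tree_set b \subset D ->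
  (forall x, x \in vertices r b) -> spanning_tree D (tree_set b).
Proof.
move=> hb b0 hD hall; split=> //; first exact: grown_acyclic.
  by apply/setP => x; rewrite inE grown_cover.
move=> x y; have [p [hp <- _]] := grown_path hb (hall x) (hall y).
exact: joined_simple.
Qed.

(** The path from the root to [y] leaves the grown part through some triple. A second old vertex in
    that triple would close a cycle with a path inside the grown part, so its other two vertices are
    new. *)
Lemma grown_extend T b y : (forall s, s \in T -> #|s| = 3) -> ~ has_cycle T ->
    joined T r y -> grown r b -> tree_set b \subset T -> y \notin vertices r b ->
  exists t, grown r (t :: b) /\ tree_set (t :: b) \subset T.
Proof.
move=> h3 hacyc [l [a [s [aI sI a0 al hs]]]] hb hbT yb.
have [i hi1 hi2] : exists2 i : 'I_l, a (widen_ord (leqnSn l) i) \in vertices r b &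
    a (lift ord0 i) \notin vertices r b.
  have [/existsP[i /andP[h1 h2]]|/existsPn hno] := boolP [exists i : 'I_l,
    (a (widen_ord (leqnSn l) i) \in vertices r b) && (a (lift ord0 i) \notin vertices r b)].
    by exists i.
  have all k (kl : k < l.+1) : a (Ordinal kl) \in vertices r b.
    elim: k kl => [|k IH] kl.
      by rewrite (_ : Ordinal kl = ord0) ?a0 ?root_vertices //; apply: val_inj.
    have := hno (Ordinal (kl : k < l)); rewrite negb_and negbK => /orP[].
      by rewrite (_ : widen_ord _ _ = Ordinal (ltnW kl)) ?IH //; apply: val_inj.
    by rewrite (_ : lift _ _ = Ordinal kl) //; apply: val_inj.
  by have := all l (ltnSn l); rewrite (_ : Ordinal _ = ord_max) ?al ?(negbTE yb) //; apply: val_inj.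
have [sT ai ai'] := hs i; set u := a _ in hi1 ai; set v := a _ in hi2 ai'.
have sb : s i \notin tree_set b.
  by apply: contra hi2 => h; apply: tree_set_vertices hb h ai'.
have meet x : x \in s i -> x \in vertices r b -> x = u.
  move=> xs xb; apply/eqP/negPn/negP => xu.
  have [p [hp1 hp2 _]] := grown_path hb xb hi1.
  apply: hacyc; apply: (cycle_simple hp1 hbT sT sb xs); first by rewrite hp2.
  by apply: contra xu => /eqP p0; rewrite -hp2 p0.
have /eqP/cards2P[y1 [z1 [yz E]]] : #|s i :\ u| = 2.
  by have := cardsD1 u (s i); rewrite ai h3 // => -[].
have Es : s i = tset (u, y1, z1).
  by rewrite -(setD1K ai) E; apply/setP => x; rewrite !inE orbA.
have new x : x \in [set y1; z1] -> x \notin vertices r b.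
  by rewrite -E !inE => /andP[xu xs]; apply: contra xu => /(meet _ xs)->.
exists (u, y1, z1); split; first by rewrite /= hi1 !new ?yz ?hb // !inE eqxx ?orbT.
by rewrite tree_set_cons -Es subUset sub1set sT.
Qed.

(** Extension must stop, because [N] attached triples would have 2 N + 1 vertices. A triple of [T]
    still left over would close a cycle with the path joining two of its vertices. *)
Lemma spanning_grown D T : (forall s, s \in D -> #|s| = 3) -> spanning_tree D T ->
  exists b, [/\ grown r b, tree_set b = T & forall x, x \in vertices r b].
Proof.
move=> hD [hTD hac _ hj]; have h3 s : s \in T -> #|s| = 3 by move/(subsetP hTD)/hD.
have key n : (exists b, [/\ grown r b, tree_set b \subset T & size b = n]) \/
    exists b, [/\ grown r b, tree_set b \subset T & forall x, x \in vertices r b].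
  elim: n => [|n [[b [h1 h2 h4]]|]]; [|  |by right].
    by left; exists [::]; split=> //; apply/subsetP => s; rewrite inE.
  have [/forallP hall|] := boolP [forall x, x \in vertices r b]; first by right; exists b.
  rewrite negb_forall => /existsP[y yb]; left.
  have [t [ht1 ht2]] := grown_extend h3 hac (hj r y) h1 h2 yb.
  by exists (t :: b); rewrite /= h4.
have [[b [h1 _ h4]]|[b [h1 h2 h4]]] := key N.
  have := uniq_leq_size (vertices_uniq h1) (fun x _ => mem_enum V x).
  by rewrite size_enum_ord size_vertices h4; lia.
exists b; split=> //; apply/eqP; rewrite eqEsubset h2; apply/subsetP => s sT.
apply/negPn/negP => sb; have /card_gt1P[x [y [xs ys xy]]] : 1 < #|s| by rewrite h3.
have [p [hp1 hp2 _]] := grown_path h1 (h4 x) (h4 y).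
apply: hac; apply: (cycle_simple hp1 h2 sT sb xs); first by rewrite hp2.
by apply: contra xy => /eqP p0; rewrite -hp2 p0.
Qed.

End SpanningTrees.

(** * Linear algebra over the field with two elements *)

Import GRing.Theory.

Lemma F2_bool (z : 'F_2) : z = (z != 0 :> 'F_2)%:R%R.
Proof. by apply: val_inj; case: z => [[|[|]]]. Qed.

Lemma F2_addb (a b : bool) : ((a (+) b)%:R = a%:R + b%:R :> 'F_2)%R.
Proof. by apply: val_inj; case: a; case: b. Qed.

Lemma F2_inj (a b : bool) : (a%:R = b%:R :> 'F_2)%R -> a = b.
Proof. by case: a; case: b => // /(congr1 val). Qed.

Lemma F2_sum (I : Type) (l : seq I) (P : pred I) (F : I -> bool) :
  ((\big[addb/false]_(i <- l | P i) F i)%:R = \sum_(i <- l | P i) (F i)%:R :> 'F_2)%R.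
Proof. exact: (big_morph (fun b : bool => b%:R : 'F_2)%R F2_addb). Qed.

Lemma addb_count (I : Type) (l : seq I) (F : pred I) :
  \big[addb/false]_(i <- l) F i = odd (count F l).
Proof. by elim: l => [|i l IH]; rewrite ?big_nil // big_cons IH oddD oddb. Qed.

(** * Refutations of the sign equations *)

Section Certificates.

Variables (N : nat) (r : 'I_N) (H : graph3 N).
Notation V := 'I_N.
Implicit Types (b : seq (V * V * V)) (bs : seq (seq (V * V * V))) (s : {set V}).

(** The part of the sign that does not involve the orientation, i.e. the constant term in the
    equation of the tree. *)
Definition bpar b : bool := invpar (vals (vertices r b)) (+)
  \big[addb/false]_(t <- b) invpar (vals (tlist t)).

Definition tree_build b : bool :=
  [&& grown r b, [forall x, x \in vertices r b] & tree_set b \subset triples H].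

Lemma tree_build_perm b : tree_build b -> perm_eq (vertices r b) (enum V).
Proof.
case/and3P=> hb /forallP hall _; apply: uniq_perm; rewrite ?enum_uniq ?vertices_uniq //.
by move=> x; rewrite mem_enum hall.
Qed.

Lemma tree_build_size b : tree_build b -> N = (size b).*2.+1.
Proof. by move=> /tree_build_perm/perm_size; rewrite size_vertices size_enum_ord. Qed.

Lemma xor_tree_set b (F : {set V} -> bool) : grown r b ->
  \big[addb/false]_(t <- b) F (tset t) = \big[addb/false]_s ((s \in tree_set b) && F s).
Proof.
move=> hb; rewrite -(big_map (@tset _) xpredT F) big_uniq ?(tset_uniq hb) //.
rewrite big_mkcond; apply: eq_bigr => s _; rewrite [in RHS]inE.
by case: (s \in _).
Qed.

Definition tree_bit omega b : bool :=
  bpar b (+) \big[addb/false]_s ((s \in tree_set b) && obit omega s).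

Lemma sgn_tree_build omega b : triple_orientation H omega -> tree_build b ->
  sgn omega (tree_set b) = ((-1) ^+ tree_bit omega b)%R.
Proof.
move=> ho hT; have hN := tree_build_perm hT; case/and3P: hT => hb _ /subsetP hH.
rewrite (sgn_grown hb hN) => [|t tb].
  by rewrite big_split /= addbA /tree_bit -xor_tree_set.
by apply: ho; apply: hH; rewrite inE map_f.
Qed.

Definition refutes bs : bool :=
  [&& all tree_build bs, ~~ odd (size bs),
      [forall s, ~~ odd (count (fun b => s \in tree_set b) bs)]
    & \big[addb/false]_(b <- bs) bpar b].

Lemma sign_inj (a b : bool) : ((-1) ^+ a = (-1) ^+ b :> int)%R -> a = b.
Proof. by case: a; case: b. Qed.

Lemma refutes_sound bs : refutes bs -> ~ pfaffian3 H.
Proof.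
case/and4P=> /allP hbs hev /forallP hs hodd [omega [ho hpf]].
have [b0 b0s nb0] : exists2 b, b \in bs & bpar b.
  apply/hasP; apply: contraTT hodd => /hasPn h.
  by rewrite big1_seq // => b /h/negbTE.
(* The empty growth sequence must be ruled out: without triples the single vertex is not covered. A
   tree with odd [bpar] is nonempty, and all trees have the same size. *)
have b0n : b0 != [::].
  by apply: contraTneq nb0 => ->; rewrite /bpar big_nil.
have span b : b \in bs -> spanning_tree (triples H) (tree_set b).
  move=> bin; have hb := hbs b bin; have /and3P[h1 /forallP h2 h3] := hb.
  apply: grown_spanning h1 _ h3 h2; apply: contra b0n => /eqP b_0.
  have := tree_build_size (hbs _ b0s); rewrite {1}(tree_build_size hb) b_0 /=.
  by case: (b0).
have hbit b : b \in bs -> tree_bit omega b = tree_bit omega b0.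
  move=> bin; apply: sign_inj; rewrite -!sgn_tree_build ?hbs //.
  by apply: hpf; apply: span.
(* The sum of all exponents is computed twice: an even number of equal bits gives 0, whereas after
   exchanging the sums each triple cancels and the constant terms leave 1. *)
have : \big[addb/false]_(b <- bs) tree_bit omega b = false.
  rewrite (eq_big_seq _ hbit) addb_count.
  by case: tree_bit; rewrite ?count_predT ?count_pred0 // (negbTE hev).
rewrite big_split /= hodd exchange_big /= big1 // => s _.
rewrite addb_count; case: obit; last first.
  by rewrite (eq_count (a2 := pred0)) ?count_pred0 // => b /=; rewrite andbF.
by under eq_count do rewrite andbT; rewrite (negbTE (hs s)).
Qed.

Lemma notation_ex (T : finType) (c : seq T) : uniq c -> exists p, is_cycle_notation c p.
Proof.
move=> uc; exists (perm (can_inj (prev_next uc))); apply/notationP; split=> // x.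
by rewrite permE.
Qed.

Lemma card3_set s : #|s| = 3 ->
  exists x y z, [/\ x != y, x != z, y != z & s = [set x; y; z]].
Proof.
move=> s3; have [s0|[x xs]] := set_0Vmem s; first by rewrite s0 cards0 in s3.
have /eqP/cards2P[y [z [yz E]]] : #|s :\ x| = 2.
  by have := cardsD1 x s; rewrite xs s3 => -[].
have new u : u \in [set y; z] -> x != u by rewrite -E !inE eq_sym => /andP[].
exists x, y, z; rewrite !new ?inE ?eqxx ?orbT //; split=> //.
by rewrite -(setD1K xs) E; apply/setP => u; rewrite !inE orbA.
Qed.

(** Reversing a triple flips its bit, so each of the two values is attained by one of the cyclic
    orders. *)
Lemma orientation_of_bits (beta : {set V} -> bool) : exists omega,
  triple_orientation H omega /\ forall s, s \in triples H -> obit omega s = beta s.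
Proof.
pose good s (p : {perm V}) := [exists t : V * V * V,
  [&& tset t == s, is_cycle_notation (tlist t) p & invpar (vals (tlist t)) == beta s]].
have hgood s : s \in triples H -> exists p, good s p.
  move=> /card_triples/card3_set[x [y [z [xy xz yz ->]]]].
  have ht t : uniq (tlist t) -> tset t = [set x; y; z] ->
      invpar (vals (tlist t)) == beta [set x; y; z] -> exists p, good [set x; y; z] p.
    move=> ut E hbeta; have [p hp] := notation_ex ut; exists p.
    by apply/existsP; exists t; rewrite E eqxx hp.
  have ut : uniq (tlist (x, y, z)) by rewrite /= !inE negb_or xy xz yz.
  have [/ht h|h] := boolP (invpar (vals (tlist (x, y, z))) == beta [set x; y; z]).
    by apply: h.
  apply: (ht (flip3 (x, y, z))); rewrite ?tset_flip //.
    by rewrite /= !inE negb_or xz xy /= eq_sym yz.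
  move: h; have E : (y < z) = ~~ (z < y).
    by case: ltngtP yz => // /val_inj->; rewrite eqxx.
  rewrite /= !addn0 !oddD !oddb E.
  by case: (y < x); case: (z < x); case: (z < y); case: (beta _).
exists (fun s => odflt 1%g [pick p | good s p]); split=> s hs.
  case: pickP => [p /existsP[[[i j] k] /and3P[/eqP E hp _]]|hno] /=.
    by exists i, j, k; rewrite -E.
  by have [p] := hgood s hs; rewrite hno.
have [p0] := hgood s hs; have := erefl (odflt 1%g [pick p | good s p]).
case: {2}[pick p | good s p] / pickP => [p /existsP[t /and3P[/eqP E hp /eqP <-]] Ep _|hno]; last by rewrite hno.
by rewrite -E obitE //= E Ep.
Qed.

Lemma refutes_complete : ~ pfaffian3 H ->
  exists2 bs, refutes bs & size bs <= #|triples H| + 2.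
Proof.
move=> hnp.
(* Every spanning tree has [N./2] triples, so the growth sequences of this length form a finite type
   that can index the rows. *)
pose R : finType := (N./2).-tuple (V * V * V); set m := #|triples H|.
pose row_of (i : 'I_#|R|) : R := enum_val i.
(* The columns are the triples, then the common sign, then the constant term; tuples that build no
   tree give zero rows. *)
pose entry (t : R) (j : 'I_(m + 2)) : bool :=
  tree_build t && match split j with
    | inl k => enum_val k \in tree_set t
    | inr k => (k == ord0) || bpar t
    end.
pose M : 'M['F_2]_(#|R|, m + 2) := (\matrix_(i, j) (entry (row_of i) j)%:R)%R.
pose e : 'rV['F_2]_(m + 2) := delta_mx 0%R (rshift m ord_max).
have entry_l (t : R) k : entry t (lshift 2 k) = tree_build t && (enum_val k \in tree_set t).
  by rewrite /entry (unsplitK (inl k)).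
have entry_1 (t : R) : entry t (rshift m ord0) = tree_build t && true.
  by rewrite /entry (unsplitK (inr ord0)).
have entry_2 (t : R) : entry t (rshift m ord_max) = tree_build t && bpar t.
  by rewrite /entry (unsplitK (inr ord_max)).
have [he|he] := boolP (e <= M)%MS.
  (* Passing to a maximal independent family of rows is what bounds the number of trees by the
     number of columns. *)
  have : (e <= rowsub (maxrankfun M) M)%MS by rewrite eq_maxrowsub.
  set f := maxrankfun M; case/submxP => y Ey.
  pose sel i := (y 0%R i != 0%R) && tree_build (row_of (f i)).
  pose bs := [seq tval (row_of (f i)) | i <- enum 'I_(\rank M) & sel i].
  have key j (g : pred (seq (V * V * V))) : (forall t : R, entry t j = tree_build t && g t) ->
      odd (count g bs) = (e 0%R j != 0%R).
    move=> hg; apply: F2_inj; rewrite -F2_bool [in RHS]Ey mxE.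
    rewrite count_map count_filter -addb_count F2_sum big_enum /=.
    apply: eq_bigr => i _; rewrite !mxE hg [in RHS](F2_bool (y 0%R i)) /sel /=.
    by case: (y 0%R i != 0%R); case: tree_build; case: (g _); apply: val_inj.
  exists bs; last first.
    rewrite /bs size_map size_filter (leq_trans (count_size _ _)) // size_enum_ord.
    exact: rank_leq_col.
  apply/and4P; split.
  - by apply/allP => b /mapP[i]; rewrite mem_filter => /andP[/andP[_ h] _] ->.
  - by rewrite -count_predT (key _ _ entry_1) mxE eq_rshift.
  - apply/forallP => s; have [hs|hs] := boolP (s \in triples H).
      have := key (lshift 2 (enum_rank_in hs s)) (fun b => s \in tree_set b).
      move=> -> => [|t]; first by rewrite mxE eq_lrshift.
      by rewrite entry_l enum_rankK_in.
    rewrite (@eq_in_count _ _ pred0) ?count_pred0 // => b.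
    case/mapP=> i; rewrite mem_filter => /andP[/andP[_ /and3P[_ _ /subsetP h]] _] ->.
    by apply: contraNF hs => /h.
  by rewrite addb_count (key _ _ entry_2) mxE !eqxx.
(* Otherwise some column [z] of the cokernel has last entry 1 and is annihilated by every row. Its
   entries at the triples serve as orientation bits, and the entry at the column of ones is the
   common sign. *)
exfalso; apply: hnp.
have [j hj] : exists j, (e *m cokermx M)%R 0%R j != 0%R.
  apply/existsP; apply: contraR he; rewrite negb_exists => /forallP h.
  rewrite submxE; apply/eqP/matrixP => i k; rewrite ord1 [RHS]mxE.
  by apply/eqP; have := h k; rewrite negbK.
rewrite -rowE mxE in hj; pose z k : 'F_2 := cokermx M k j.
have hz (t : R) : (\sum_k (entry t k)%:R * z k = 0)%R.
  have /matrixP/(_ (enum_rank t) j) := mulmx_coker M; rewrite [RHS]mxE [LHS]mxE => E; rewrite -[RHS]E.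
  by apply: eq_bigr => k _; rewrite mxE /row_of enum_rankK.
pose beta s := [exists k : 'I_m, (enum_val k == s) && (z (lshift 2 k) != 0%R)].
have [omega [ho hbeta]] := orientation_of_bits beta.
suff hsgn T : spanning_tree (triples H) T ->
    sgn omega T = ((-1) ^+ (z (rshift m ord0) != 0%R))%R.
  by exists omega; split=> // T1 T2 /hsgn-> /hsgn->.
move=> hT; have [b [h1 h2 h3]] := spanning_grown r (@card_triples _ H) hT.
have tb : tree_build b.
  by rewrite /tree_build h1 h2; case: hT => -> _ _ _; rewrite andbT; apply/forallP.
rewrite -h2 sgn_tree_build //; congr (_ ^+ nat_of_bool _)%R.
have sb : size b == N./2 by apply/eqP; have := tree_build_size tb; lia.
have := hz (Tuple sb); rewrite big_split_ord /= big_ord_recl big_ord1 entry_1.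
rewrite (_ : rshift m (lift ord0 ord0) = rshift m ord_max); last by apply: val_inj.
rewrite entry_2 /= tb /=.
have -> : z (rshift m ord_max) = 1%R by rewrite (F2_bool (z _)) hj.
have -> : (\sum_(i < m) (entry (Tuple sb) (lshift 2 i))%:R * z (lshift 2 i) =
    (\big[addb/false]_s ((s \in tree_set b) && obit omega s))%:R)%R.
  rewrite F2_sum [RHS](bigID (mem (triples H))) /=.
  have -> : (\sum_(s | s \notin triples H) ((s \in tree_set b) && obit omega s)%:R = 0 :> 'F_2)%R.
    apply: big1 => s hs; case: (boolP (s \in tree_set b)) => // sT; move: hs.
    by case/and3P: tb => _ _ /subsetP ->.
  rewrite addr0.
  rewrite [RHS]big_enum_val /=; apply: eq_bigr => k _; rewrite entry_l tb /=.
  rewrite hbeta ?enum_valP // (F2_bool (z _)) -natrM mulnb; congr (_ && _)%:R%R.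
  apply/idP/existsP => [h|[k' /andP[/eqP/enum_val_inj ->]]] //.
  by exists k; rewrite eqxx.
rewrite {1}(F2_bool (z _)) mul1r mulr1 /tree_bit; move: (bigop _ _ _) => x.
by case: (z _ != _); case: (bpar b); case: x => // /(congr1 val).
Qed.

End Certificates.

(** * Certificates as lists of numbers *)

Section Certify.

Variables (N : nat) (r : 'I_N) (H : graph3 N) (ts : seq ('I_N * 'I_N * 'I_N)).
Notation V := 'I_N.
Notation num := (map3 (@nat_of_ord N)).
Hypothesis r0 : r = 0 :> nat.
Hypothesis tsH : triples H = [set s in map (@tset _) ts].
Hypothesis tsU : all (fun t => uniq (tlist t)) ts.

Let I := map num ts.

Implicit Types (t : V * V * V) (b : seq (V * V * V)) (bs : seq (seq (V * V * V))).

(** Certificates are read in the order of attachment, whereas growth sequences have the newest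
    triple first. *)
Definition forward b : seq (triple3 nat) := map num (rev b).

Lemma forward_cons t b : forward (t :: b) = rcons (forward b) (num t).
Proof. by rewrite /forward rev_cons map_rcons. Qed.

Lemma placed_rcons l (x : triple3 nat) : placed (rcons l x) = placed l ++ [:: x.1.2; x.2].
Proof. by rewrite /placed map_rcons flatten_rcons. Qed.

Lemma placed_forward b : perm_eq (rcons (placed (forward b)) 0) (vals (vertices r b)).
Proof.
elim: b => [|t b IH]; first by rewrite /= r0.
rewrite forward_cons placed_rcons /= -cats1 -catA perm_catCA /= !perm_cons.
by rewrite cats1.
Qed.

Lemma mem_placed b (x : V) :
  (x \in vertices r b) = (x == 0 :> nat) || (nat_of_ord x \in placed (forward b)).
Proof.
rewrite -(mem_map val_inj) -[map _ _]/(vals _) -(perm_mem (placed_forward b)).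
by rewrite mem_rcons inE.
Qed.

Lemma mem3_num (x : V) t : mem3 x (num t) = (x \in tlist t).
Proof. by rewrite !inE. Qed.

Lemma same_num t t' : uniq (tlist t) -> uniq (tlist t') ->
  same (num t) (num t') = (tset t == tset t').
Proof.
move=> ut ut'; have -> : same (num t) (num t') = (tset t \subset tset t').
  rewrite /same !mem3_num; apply/and3P/subsetP => [[h1 h2 h3] x|h].
    have /allP h : all [in tlist t'] (tlist t) by rewrite /= h1 h2 h3.
    by rewrite !in_tset; apply: h.
  by split; rewrite -in_tset h // in_tset !inE eqxx ?orbT.
have card (u : V * V * V) : uniq (tlist u) -> #|tset u| = 3.
  move=> uu; rewrite -[3]/(size (tlist u)) -(card_uniqP uu).
  by apply: eq_card => x; exact: in_tset.
by rewrite eqEcard !card // andbT.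
Qed.

Lemma has_same t : uniq (tlist t) -> has (same (num t)) I = (tset t \in triples H).
Proof.
move=> ut; rewrite tsH inE has_map; apply/hasP/mapP => -[t' t's].
  rewrite /= same_num //; last exact: (allP tsU).
  by move/eqP => ->; exists t'.
by move=> E; exists t' => //=; rewrite same_num ?E //; apply: (allP tsU).
Qed.

Lemma admissible_num b t : grown r b ->
  admissible N I (forward b) (num t) = grown r (t :: b) && (tset t \in triples H).
Proof.
move=> hb; rewrite /admissible /= !ltn_ord hb andbT /=.
rewrite (inj_eq val_inj) !mem_placed !negb_or.
case: (boolP (t.1.2 == t.2)) => [|h1]; first by rewrite /= !andbF.
case: (boolP (t.1.2 == 0 :> nat)) => [|h2]; first by rewrite /= !andbF.
case: (boolP (t.2 == 0 :> nat)) => [|h3]; first by rewrite /= !andbF.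
rewrite /=; case: (boolP (_ || _)) => //= h4.
case: (boolP (_ \in _)) => //= h5; case: (boolP (_ \in _)) => //= h6.
apply: has_same; apply: (@grown_uniq3 _ r (t :: b)); last exact: mem_head.
by rewrite /= !mem_placed h1 hb h4 (negbTE h2) (negbTE h3) h5 h6.
Qed.

Lemma count_gt_lt (x : nat) l : x \notin l -> odd (size l) ->
  odd (count (fun y => y < x) l) = ~~ odd (count (fun y => x < y) l).
Proof.
move=> xl; rewrite -(count_predC (fun y => y < x)) oddD.
rewrite (@eq_in_count _ (predC (fun y => y < x)) (fun y => x < y)) => [|y yl /=].
  by do 2 case: odd.
by rewrite -leqNgt leq_eqVlt; case: eqP => // E; rewrite E yl in xl.
Qed.

(** The vertices present are odd in number, so the counts of smaller and of larger ones have
    opposite parities; the two resulting negations cancel. So does [t.2 < t.1.2], which arises once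
    in the word and once in the triple. *)
Lemma tpar_num b t : grown r (t :: b) ->
  tpar (forward b) (num t) = bpar r (t :: b) (+) bpar r b.
Proof.
case/and5P=> ha hy hz yz hb; rewrite /tpar /bpar big_cons.
have cnt x : count (fun y => x < y) (placed (forward b)) =
    count (fun y => x < y) (vals (vertices r b)).
  by have /seq.permP <- := placed_forward b; rewrite -cats1 count_cat /= !addn0.
have szv : odd (size (vals (vertices r b))).
  by rewrite size_map size_vertices /= odd_double.
have ny : (nat_of_ord t.1.2) \notin vals (vertices r b) by rewrite mem_map //; apply: val_inj.
have nz : (nat_of_ord t.2) \notin vals (vertices r b) by rewrite mem_map //; apply: val_inj.
rewrite !cnt /= -/(vals _) !addn0 !oddD !oddb !count_gt_lt //.
move: (odd (count _ _)) (odd (count _ _)) (invpar _) (bigop _ _ _) => [] [] [] [];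
  by case: (t.2 < t.1.2); case: (t.1.2 < t.1.1); case: (t.2 < t.1.1).
Qed.

Lemma mem_downto x n : (x \in downto n) = (0 < x <= n).
Proof.
elim: n => [|n IH]; first by rewrite in_nil; lia.
by rewrite inE IH; lia.
Qed.

Lemma covers_num b : covers N (forward b) = [forall x, x \in vertices r b].
Proof.
apply/allP/forallP => [h x|h x].
  rewrite mem_placed; have [//|x0] := eqVneq (x : nat) 0.
  by apply: h; rewrite mem_downto lt0n x0 /=; have := ltn_ord x; lia.
rewrite mem_downto => /andP[x0 xN]; have xN' : x < N by lia.
by have := h (Ordinal xN'); rewrite mem_placed /= -(negbK (x == 0)) -lt0n x0.
Qed.

Lemma sep_num t : sep N (num t) = false.
Proof. by rewrite /sep leqNgt ltn_ord. Qed.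

(* What a fold over the certificate has established: [bs] are the completed
   trees and [b] is the one in progress. *)
Definition explains C bs b pf pe : Prop :=
  [/\ all (tree_build r H) bs, grown r b, tree_set b \subset triples H,
      pf = \big[addb/false]_(b' <- b :: bs) bpar r b' /\ pe = odd (size bs)
    & forall t, uniq (tlist t) ->
        count (fun x => ~~ sep N x && same (num t) x) C =
        count (fun b' => tset t \in tree_set b') (b :: bs)].

Lemma bpar_nil : bpar r [::] = false.
Proof. by rewrite /bpar big_nil. Qed.

Lemma explains_sep C bs b pf pe x : explains C bs b pf pe -> sep N x ->
  covers N (forward b) -> explains (rcons C x) (b :: bs) [::] pf (~~ pe).
Proof.
case=> h1 h2 h3 [h4 h5] h6 ht hc; split=> //=.
- by rewrite h1 /tree_build h2 h3 -covers_num hc.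
- by apply/subsetP => s; rewrite inE.
- by rewrite big_cons bpar_nil h4 h5.
by move=> u uu; rewrite -cats1 count_cat /= ht /= !addn0 h6 //= [tset u \in tree_set [::]]inE.
Qed.

Lemma explains_step C bs b pf pe t : explains C bs b pf pe -> grown r (t :: b) ->
  tset t \in triples H ->
  explains (rcons C (num t)) bs (t :: b) (pf (+) tpar (forward b) (num t)) pe.
Proof.
case=> h1 h2 h3 [h4 h5] h6 ht htT; split=> //.
- by rewrite tree_set_cons subUset sub1set htT.
- rewrite tpar_num // h4 !big_cons h5; split=> //.
  by case: (bpar r b); case: (bpar r _); case: (bigop _ _ _).
move=> u uu; rewrite -cats1 count_cat /= sep_num /= !addn0 h6 //=.
rewrite same_num //; last exact: grown_uniq3 ht (mem_head _ _).
rewrite tree_set_cons [in RHS]inE in_set1; have := tset_new ht.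
case: eqP => [-> /negbTE-> /=|_ _]; first by rewrite add0n addnC.
by rewrite addn0.
Qed.

Lemma trees_explained C cur pf pe last :
    foldl (vstep N I) ([::], (true, false, false, true)) C = (cur, (true, pf, pe, last)) ->
  exists bs b, [/\ cur = forward b, explains C bs b pf pe & last -> b = [::]].
Proof.
elim/last_ind: C cur pf pe last => [|C t IH] cur pf pe last.
  move=> [<- <- <- <-]; exists [::], [::]; split=> //; split=> //.
  - by apply/subsetP => s; rewrite inE.
  - by rewrite big_seq1 bpar_nil.
  by move=> t _; rewrite /= inE.
rewrite foldl_rcons; case E: (foldl _ _ C) => [cur' [[[ok pf'] pe'] last']] /=.
have [hs [hcur hok hpf hpe hl]|hs [hcur hok hpf hpe hl]] := boolP (sep N t).
  case: ok E hok => // E hc; have [bs [b [Ecur hex _]]] := IH _ _ _ _ E.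
  exists (b :: bs), [::]; split=> //; rewrite -hpf -hpe.
  by apply: explains_sep hex hs _; rewrite -Ecur.
case: ok E hok => // E hadm; have [bs [b [Ecur hex _]]] := IH _ _ _ _ E.
have [h1 h2 h3 _ _] := hex; rewrite /= in hadm.
(* Since [t] is no end mark, its first entry is below [N], and admissibility bounds the others;
   hence [t] comes from actual vertices. *)
have tlt : [&& t.1.1 < N, t.1.2 < N & t.2 < N].
  by rewrite ltnNge -/(sep N t) hs; case/and5P: hadm => -> ->.
have {tlt} [u Eu] : exists u, t = num u.
  case: (t) tlt => [[x y] z] /= /and3P[hx hy hz].
  by exists (Ordinal hx, Ordinal hy, Ordinal hz).
rewrite Eu Ecur in hadm; move: hadm; rewrite admissible_num // => /andP[hg hT].
exists bs, (u :: b); split; first by rewrite -hcur Ecur Eu forward_cons.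
  by rewrite -hpf -hpe Eu Ecur; apply: explains_step.
by rewrite -hl.
Qed.

Lemma cert_sound C : cert_ok N I C -> ~ pfaffian3 H.
Proof.
case/andP=> /allP heven; rewrite /trees_ok.
case E: (foldl _ _ C) => [cur [[[ok pf] pe] last]] /= /and4P[hok hpf hpe hl].
case: ok E hok => // E _; have [bs [b [_ hex hb]]] := trees_explained E.
rewrite (hb hl) in hex; case: hex => h1 _ _ [h4 h5] h6.
apply: (@refutes_sound _ r H bs); apply/and4P; split=> //.
- by rewrite -h5.
- apply/forallP => s; have [sH|sH] := boolP (s \in triples H).
    move: sH; rewrite tsH inE => /mapP[t tts ->].
    have := heven _ (map_f num tts); rewrite h6; last exact: (allP tsU).
    by rewrite /= inE add0n.
  rewrite (@eq_in_count _ _ pred0) ?count_pred0 // => b' /(allP h1)/and3P[_ _ /subsetP h].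
  by apply: contraNF sH => /h.
by move: hpf; rewrite h4 big_cons bpar_nil.
Qed.

Definition cert_of bs : seq (triple3 nat) :=
  flatten [seq rcons (forward b) (N, 0, 0) | b <- bs].

Lemma fold_forward b pf pe last : grown r b -> tree_set b \subset triples H ->
  exists last', foldl (vstep N I) ([::], (true, pf, pe, last)) (forward b) =
    (forward b, (true, pf (+) bpar r b, pe, last')).
Proof.
elim: b => [|t b IH] hb hH; first by exists last; rewrite bpar_nil addbF.
have /and5P[_ _ _ _ hb'] := hb; move: hH; rewrite tree_set_cons subUset sub1set => /andP[hT hH].
have [last' E] := IH hb' hH; exists false.
rewrite forward_cons foldl_rcons E /= sep_num tpar_num // admissible_num // hb hT /=.
by case: (pf); case: (bpar r _); case: (bpar r _).
Qed.

Lemma fold_tree b pf pe last : tree_build r H b ->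
  foldl (vstep N I) ([::], (true, pf, pe, last)) (rcons (forward b) (N, 0, 0)) =
    ([::], (true, pf (+) bpar r b, ~~ pe, true)).
Proof.
case/and3P=> hb hall hH; have [last' E] := fold_forward pf pe last hb hH.
by rewrite foldl_rcons E /= /sep leqnn covers_num hall.
Qed.

Lemma fold_cert bs pf pe : all (tree_build r H) bs ->
  foldl (vstep N I) ([::], (true, pf, pe, true)) (cert_of bs) =
    ([::], (true, pf (+) \big[addb/false]_(b <- bs) bpar r b, pe (+) odd (size bs), true)).
Proof.
elim: bs pf pe => [|b bs IH] pf pe /=; first by rewrite big_nil !addbF.
case/andP=> hb hbs; rewrite /cert_of /= foldl_cat fold_tree // IH // big_cons addbA.
by rewrite addbN addNb.
Qed.

Lemma cert_complete bs : refutes r H bs -> cert_ok N I (cert_of bs).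
Proof.
case/and4P=> hbs hev /forallP hs hpar; apply/andP; split; last first.
  by rewrite /trees_ok fold_cert //= hpar (negbTE hev).
have /allP tU := tsU; apply/allP => _ /mapP[t tts ->]; have ut := tU t tts.
suff -> : count (fun x => ~~ sep N x && same (num t) x) (cert_of bs) =
    count (fun b => tset t \in tree_set b) bs by apply: hs.
elim: bs hbs {hev hs hpar} => //= b bs IH /andP[/and3P[hb _ _] /IH {}IH].
rewrite /cert_of /= count_cat IH -cats1 count_cat /= /sep leqnn /= !addn0; congr (_ + _).
rewrite /forward count_map count_rev.
have -> : (tset t \in tree_set b : nat) = count (pred1 (tset t)) (map (@tset _) b).
  by rewrite count_uniq_mem ?(tset_uniq hb) // inE.
rewrite count_map; apply: eq_in_count => t' tb' /=.
by rewrite -/(sep N (num t')) sep_num same_num 1?eq_sym //; apply: grown_uniq3 hb tb'.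
Qed.

End Certify.

(** * Encoding *)

Definition codes (l : seq nat) : seq bool := flatten (map vertex_code l).

Definition flat3 (T : Type) (C : seq (triple3 T)) : seq T :=
  flatten [seq [:: t.1.1; t.1.2; t.2] | t <- C].

Lemma size_flat3 (T : Type) (C : seq (triple3 T)) : size (flat3 C) = size C * 3.
Proof. by elim: C => //= t C; rewrite mulSn => <-. Qed.

Lemma grp3_flat3 (T : Type) (C : seq (triple3 T)) : grp3 (flat3 C) = C.
Proof. by elim: C => //= -[[x y] z] C IH; rewrite /= -/(flat3 C) IH. Qed.

Lemma flat3_grp3 (T : Type) (l : seq T) : 3 %| size l -> flat3 (grp3 l) = l.
Proof.
by elim/grp3_ind: l => //= x y z l IH h; rewrite /flat3 /= -/(flat3 _) IH.
Qed.

Lemma nums_code v w : nums true (vertex_code v ++ w) = v :: nums true w.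
Proof.
have E k : nums false (nseq k true ++ false :: w) = nums true w by elim: k.
rewrite /vertex_code cat_rcons; case: v => [|v] //=; rewrite E; congr (_.+1 :: _).
by elim: v => //= v ->.
Qed.

Lemma nums_codes l : nums true (codes l) = l.
Proof. by elim: l => //= v l IH; rewrite /codes /= nums_code -/(codes l) IH. Qed.

Lemma codes_nums w : ~~ last false w -> codes (nums true w) = w.
Proof.
(* The second clause treats a suffix that starts inside a block, as the induction meets one after
   reading a 1. *)
suff: (~~ last false w -> codes (nums true w) = w) /\
      (~~ last true w -> vertex_code (find negb w) ++ codes (nums false w) = w).
  by case.
elim: w => [|[] w [IH1 IH2]] //=; split=> // h.
- by rewrite /codes /= -/(codes _) -cat_cons -[true :: vertex_code _]/(vertex_code _.+1) /= IH2.
- by rewrite /= IH2.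
- by rewrite /codes /= -/(codes _) IH1.
by rewrite /= IH1.
Qed.

Lemma count_codes l : count negb (codes l) = size l.
Proof.
elim: l => //= v l IH; rewrite /codes /= count_cat -/(codes l) IH /vertex_code.
by rewrite -cats1 count_cat count_nseq.
Qed.

Lemma last_codes l x : last x (codes l) = if l is [::] then x else false.
Proof.
elim: l x => //= v l IH x; rewrite /codes /= last_cat -/(codes l) IH.
by rewrite /vertex_code last_rcons; case: l {IH}.
Qed.

Lemma size_codes l m : all (fun v => v <= m) l -> size (codes l) <= size l * m.+1.
Proof.
elim: l => //= v l IH /andP[hv hl]; rewrite /codes /= size_cat -/(codes l).
by rewrite /vertex_code size_rcons size_nseq mulSn leq_add // IH.
Qed.

Lemma leq_size_codes l : size l <= size (codes l).
Proof. by rewrite -(count_codes l) count_size. Qed.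

Section Encoding.

Variables (N : nat).
Notation num := (map3 (@nat_of_ord N)).
Implicit Types (ts : seq ('I_N * 'I_N * 'I_N)).

Lemma triple_codes ts :
  flatten [seq triple_code t | t <- ts] = codes (flat3 (map num ts)).
Proof.
elim: ts => // -[[i j] k] ts IH.
by rewrite /= IH /codes /flat3 /= -!catA.
Qed.

Lemma encoded_word ts :
  nseq N true ++ false :: flatten [seq triple_code t | t <- ts] =
  codes (N :: flat3 (map num ts)).
Proof. by rewrite triple_codes /codes /= /vertex_code cat_rcons. Qed.

Lemma triple_setE (t : 'I_N * 'I_N * 'I_N) : triple_set t = tset t.
Proof. by case: t => [[]]. Qed.

Lemma tset_card (t : 'I_N * 'I_N * 'I_N) : (#|tset t| == 3) = uniq (tlist t).
Proof.
rewrite (_ : #|tset t| = #|tlist t|); last by apply: eq_card => x; exact: in_tset.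
by apply/eqP/card_uniqP.
Qed.

Lemma input_num (t : 'I_N * 'I_N * 'I_N) : input_triple N (num t) = uniq (tlist t).
Proof. by rewrite /input_triple /= !ltn_ord !inE negb_or /= andbT -andbA. Qed.

Lemma encodes_triples w (H : graph3 N) : encodes w H -> exists ts,
  [/\ w = codes (N :: flat3 (map num ts)), triples H = [set s in map (@tset _) ts]
    & all (fun t => uniq (tlist t)) ts].
Proof.
case=> ts [-> hH]; exists ts; rewrite encoded_word.
have hT : triples H = [set s in map (@tset _) ts].
  by rewrite hH (eq_map triple_setE).
split=> //; apply/allP => t tts; rewrite -tset_card; apply/eqP/(@card_triples _ H).
by rewrite hT inE map_f.
Qed.

Lemma triples_encode ts : all (fun t => uniq (tlist t)) ts ->
  exists H : graph3 N, encodes (codes (N :: flat3 (map num ts))) H.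
Proof.
move=> /allP hts.
have hcard s : s \in [set s in map (@triple_set N) ts] -> #|s| = 3.
  by rewrite inE => /mapP[t /hts + ->]; rewrite triple_setE -tset_card => /eqP.
by exists (Graph3 hcard), ts; rewrite encoded_word.
Qed.

End Encoding.

(** * Well-formed inputs, the size of certificates and the theorem *)

Definition well_formed (w : seq bool) : bool :=
  shape_ok w && all (input_triple (head 0 (nums true w))) (grp3 (behead (nums true w))).

Lemma encoded_well_formed N (ts : seq ('I_N * 'I_N * 'I_N)) :
  all (fun t => uniq (tlist t)) ts -> well_formed (codes (N :: flat3 (map (map3 (@nat_of_ord N)) ts))).
Proof.
move=> hts; rewrite /well_formed nums_codes /= grp3_flat3 all_map.
rewrite (eq_all (a2 := fun t => uniq (tlist t))) => [|t]; last exact: input_num.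
rewrite hts andbT /shape_ok last_codes count_codes /=.
by rewrite size_flat3 size_map -addn1 modnMDl.
Qed.

Lemma well_formed_encodes w : well_formed w -> exists N (H : graph3 N), encodes w H.
Proof.
case/andP=> /andP[hl hc] hI.
have hl' : ~~ last false w by case: (w) hl.
have ew := codes_nums hl'; move: hc; rewrite -ew count_codes ew.
case: (nums true w) ew hI => [|N l] //= ew hI hs.
have hs3 : 3 %| size l by rewrite /dvdn; lia.
have [ts hts] : exists ts : seq ('I_N * 'I_N * 'I_N), map (map3 (@nat_of_ord N)) ts = grp3 l.
  elim: (grp3 l) hI => [|[[x y] z] C IH] /=; first by exists [::].
  case/andP=> /and4P[/= hx hy hz _] /IH[ts hts].
  by exists ((Ordinal hx, Ordinal hy, Ordinal hz) :: ts); rewrite /= hts.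
exists N; rewrite -ew -(flat3_grp3 hs3) -hts; apply: triples_encode.
move: hI; rewrite -hts all_map; apply: sub_all => t.
by rewrite -input_num.
Qed.

(** Without vertices there is no root, so [cert_sound] does not apply. But then every triple is an
    end mark, and the parity [pf] never changes. *)
Lemma cert_ok0 I C : cert_ok 0 I C = false.
Proof.
apply/negbTE; rewrite negb_and /trees_ok; apply/orP; right.
suff: forall cur st, st.1.1.2 = false ->
    (foldl (vstep 0 I) (cur, st) C).2.1.1.2 = false.
  by move/(_ [::] (true, false, false, true) erefl); case: foldl => ? [[[? ?] ?] ?] /= ->; rewrite andbF.
elim: C => //= t C IH cur [[[ok pf] pe] last] /= ->; exact: IH.
Qed.

Lemma pfaffian_empty (H : graph3 0) : pfaffian3 H.
Proof.
have H0 : triples H = set0.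
  apply/setP => s; rewrite inE; apply/negbTE/negP => /card_triples.
  have : #|s| <= 0 by rewrite -[X in _ <= X](card_ord 0) max_card.
  by move=> + E; rewrite E.
exists (fun=> 1%g); split=> [s|T1 T2 [h1 _ _ _] [h2 _ _ _]]; first by rewrite H0 inE.
by move: h1 h2; rewrite H0 !subset0 => /eqP-> /eqP->.
Qed.

Lemma size_cert_codes N (r : 'I_N) (H : graph3 N) bs : all (tree_build r H) bs ->
  size (codes (flat3 (cert_of bs))) <= size bs * N.+1 * 3 * N.+1.
Proof.
move=> hbs.
have szc : size (cert_of bs) <= size bs * N.+1.
  elim: bs hbs => //= b bs IH /andP[hb /IH {}IH]; rewrite /cert_of /= size_cat mulSn.
  apply: leq_add => //; rewrite size_rcons size_map size_rev.
  rewrite ltnS; apply: leq_trans (eq_leq (esym (tree_build_size hb))).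
  by rewrite -addnn -addnS leq_addr.
apply: leq_trans (size_codes (m := N) _) _; last by rewrite size_flat3 !leq_mul.
apply/allP => v /flattenP[_ /mapP[t tC ->]].
move: tC => /flattenP[_ /mapP[b _ ->]]; rewrite mem_rcons inE => /predU1P[->|].
  by rewrite !inE => /or3P[] /eqP->.
by case/mapP=> u _ ->; rewrite !inE => /or3P[] /eqP->; rewrite /= ltnW.
Qed.

Theorem theorem4p12 : inCoNP PFAFFIAN3.
Proof.
(* The factors bound, in this order, the number of trees, the triples per tree including the end
   mark, the numbers per triple and the letters per number. *)
exists (fun W => is_true (eval W verifier 1 (fun=> 0))), (('X + 2%:P) * 'X * 3%:P * 'X)%R.
split=> [|w]; first exact: inP_eval.
split=> [hn|[u _]].
  have [wf|nwf] := boolP (well_formed w); last first.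
    by exists [::] => //; rewrite eval_verifier -/(well_formed w) nwf.
  have [N [H hH]] := well_formed_encodes wf.
  have hnp : ~ pfaffian3 H by move=> hp; apply: hn; exists N, H.
  have [ts [ew hT hU]] := encodes_triples hH.
  (* [refutes_complete] needs a root; the graph without vertices is Pfaffian anyway. *)
  case: N H hH hnp ts ew hT hU => [|n] H hH hnp ts ew hT hU.
    by case: hnp; apply: pfaffian_empty.
  have [bs hbs sbs] := refutes_complete (ord0 : 'I_n.+1) hnp.
  exists (codes (flat3 (cert_of bs))); last first.
    rewrite eval_verifier; apply/orP; right.
    rewrite nums_codes ew nums_codes /= !grp3_flat3.
    exact: (@cert_complete _ ord0 H).
  have /and4P[hall _ _ _] := hbs.
  apply: leq_trans (size_cert_codes hall) _.
  rewrite !hornerM hornerD !hornerX !hornerC.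
  (* The header alone has [n.+2] letters, and every listed triple adds at least one. *)
  have sw : n.+2 + size ts <= size w.
    rewrite ew -[codes _]/(vertex_code _ ++ codes _) size_cat size_rcons size_nseq.
    rewrite leq_add2l; apply: leq_trans (leq_size_codes _).
    by elim: (ts) => //= t l; rewrite /flat3 /= => h; lia.
  have sT : #|triples H| <= size ts.
    by rewrite hT cardsE -(size_map (@tset _) ts) card_size.
  rewrite -[leqRHS]/((size w + 2) * size w * 3 * size w).
  have a1 : n.+2 <= size w := leq_trans (leq_addr _ _) sw.
  have a2 : size bs <= size w + 2.
    by rewrite (leq_trans sbs) // leq_add2r (leq_trans sT) // (leq_trans (leq_addl _ _) sw).
  by rewrite !leq_mul.
rewrite eval_verifier -/(well_formed w) => hu [N [H [hH hp]]].
have [ts [ew hT hU]] := encodes_triples hH.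
move: hu; rewrite ew encoded_well_formed //= nums_codes /= grp3_flat3.
case: N H hH hp ts ew hT hU => [|n] H hH hp ts ew hT hU; first by rewrite cert_ok0.
by move=> hc; apply: (@cert_sound _ ord0 H ts _ hT hU _ hc).
Qed.
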